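(* Let $m$ be the mean function of the non-stationary asymptotical regularization method (ARM) on $[0,T]$, $T>0$, as described in the context, let $\varphi$ be the index function in the source condition $m_0-u^\dagger\in\mathcal A_\varphi$, and let $p>0$ be the exponent with $\Omega=(K^*K)^p$. 1. If the function $\lambda\mapsto \varphi(\lambda)/\lambda^{p+1}$ is non-increasing, then for all $0<t\le T$ $$\mathbb E\|m(t)-u^\dagger\|^2\le \varphi^2\Big(\big(\tfrac{\alpha}{t}\big)^{\frac1{p+1}}\Big)+\alpha^{-\frac1{p+1}}t^{-\frac p{p+1}}\,\mathcal N\big(\tfrac{\alpha}{t}\big).$$ 2. If there is a constant $c<\infty$ with $\varphi(\lambda)\le c\,\lambda^{p+1}$ as $\lambda\to0$ (i.e. for all sufficiently small $\lambda>0$), then there is a constant $c'<\infty$, independent of $t$, $T$ and $\alpha$, such that for all $0<t\le T$ $$\mathbb E\|m(t)-u^\dagger\|^2\le c'\big(\tfrac{\alpha}{t}\big)^2+\alpha^{-\frac1{p+1}}t^{-\frac p{p+1}}\,\mathcal N\big(\tfrac{\alpha}{t}\big).$$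
   Context: Setting. $\mathcal X,\mathcal Y$ are separable Hilbert spaces, $A:\mathcal X\to\mathcal Y$ is a compact linear operator, $u^\dagger\in\mathcal X$ is the (deterministic) exact solution and $m_0\in\mathcal X$ a deterministic initial mean. The following is assumed. (Assumption on covariances) The noise covariance operator $\Sigma$ on $\mathcal Y$ is self-adjoint and positive definite. The initial covariance is $C_0=\alpha^{-1}\Omega$ with a parameter $\alpha>0$ and a self-adjoint, positive definite, trace class operator $\Omega$ on $\mathcal X$ (positive definite: $\langle x,\Omega x\rangle>0$ for $x\ne0$). (Assumption on operators) $\mathcal R(A)\subset\mathcal D(\Sigma^{-1/2})$, and $K:=\Sigma^{-1/2}A$; there is $p>0$ with $\Omega=(K^*K)^p$; and $\|K\|\le1$. (Source condition) An index function is a non-decreasing continuous function $\varphi:(0,\infty)\to(0,\infty)$ with $\lim_{\lambda\searrow0}\varphi(\lambda)=0$ (extended by $\varphi(0)=0$). For an index function $\varphi$, $m_0-u^\dagger\in\mathcal A_\varphi:=\{x:\ x=\varphi(K^*K)v,\ \|v\|\le1\}$. Put $B:=\Sigma^{-1/2}A\Omega^{1/2}=K\Omega^{1/2}$, so that $B^*B=(K^*K)^{p+1}$ and $\Omega=(B^*B)^{p/(p+1)}$. The effective dimension is $\mathcal N(\epsilon):=\operatorname{tr}\big((\epsilon I+B^*B)^{-1}B^*B\big)$ for $\epsilon>0$. Observation and method. The observed process is $\mathrm dz=Au^\dagger\,\mathrm dt+\sqrt\Sigma\,\mathrm dW$, $z(0)=0$, on $[0,T]$, where $W$ is a standard (cylindrical)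 Wiener process on $\mathcal Y$. The non-stationary ARM is the process $m$ solving $$\mathrm dm=(C_0^{-1}+tA^*\Sigma^{-1}A)^{-1}A^*\Sigma^{-1}(\mathrm dz-Am\,\mathrm dt),\qquad m(0)=m_0.$$ Here $A^*\Sigma^{-1}A$ and $A^*\Sigma^{-1/2}$ are understood as $K^*K$ and $K^*$. With $C(s):=(C_0^{-1}+sK^*K)^{-1}$ ($C(0)=C_0$), the solution is understood in the variation-of-constants sense $$u^\dagger-m(t)=e^{-\int_0^tC(s)K^*K\,\mathrm ds}(u^\dagger-m_0)-\int_0^te^{-\int_s^tC(\tau)K^*K\,\mathrm d\tau}C(s)K^*\,\mathrm dW(s).$$ $\mathbb E\|\cdot\|^2$ denotes the expected squared norm in $\mathcal X$. *)

(* Defs.v *)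
From HB Require Import structures.
From mathcomp Require Import all_boot all_order all_algebra.
From mathcomp Require Import all_classical all_reals all_analysis.

Set Implicit Arguments.
Unset Strict Implicit.
Unset Printing Implicit Defensive.

Import Order.TTheory GRing.Theory Num.Theory.
Import numFieldNormedType.Exports.

Local Open Scope classical_set_scope.
Local Open Scope ring_scope.

HB.mixin Record CompleteNormedModule_isHilbert (R : realType) H
    of CompleteNormedModule R H := {
  dotp : {dot H for (@idfun R)} ;
  dotp_norm : forall x : H, dotp x x = `|x| ^+ 2 }.

#[short(type="hilbertType")]
HB.structure Definition Hilbert (R : realType) :=
  { H of CompleteNormedModule R H & CompleteNormedModule_isHilbert R H }.

Definition separable (T : topologicalType) :=
  exists S : set T, countable S /\ dense S.

Section operators.
Context (R : realType).

(* The operator norm, +oo for unbounded operators. *)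
Definition opnorm (U V : normedModType R) (T : U -> V) : \bar R :=
  ereal_sup [set `|T x|%:E | x in [set x | `|x| <= 1]].

Definition compact_operator (U V : normedModType R) (T : U -> V) : Prop :=
  precompact (T @` [set x | `|x| <= 1]).

Context (U V : hilbertType R).

(* The inverse of T with domain D, as a total function equal to 0 outside of
   T(D); D <> setT when T stands for an unbounded operator. *)
Definition op_inv (D : set U) (T : U -> V) : V -> U := 'pinv_(fun=> 0) D T.

(* The adjoint of a bounded linear operator T, unique by nondegeneracy. *)
Definition adjoint (T : U -> V) (y : V) : U :=
  xget 0 [set x | forall u, dotp (T u) y = dotp u x].

Definition self_adjoint (T : U -> U) : Prop :=
  forall x y, dotp (T x) y = dotp x (T y).

Definition positive_definite (T : U -> U) : Prop :=
  forall x, x != 0 -> 0 < dotp x (T x).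

(* S = T^{1/2}, the (unique) nonnegative square root of T. *)
Record is_sqrt (T : U -> U) (S : {linear U -> U}) : Prop := {
  sqrt_continuous : continuous S ;
  sqrt_self_adjoint : self_adjoint S ;
  sqrt_ge0 : forall x, 0 <= dotp x (S x) ;
  sqrtK : forall x, S (S x) = T x }.

Record is_orthonormal_basis (E : set U) : Prop := {
  onb_orthonormal : forall e f, E e -> E f -> dotp e f = (e == f)%:R ;
  onb_total : forall x, (forall e, E e -> dotp x e = 0) -> x = 0 }.

(* A fixed orthonormal basis; the traces and Hilbert-Schmidt norms below do not
   depend on the choice. *)
Definition onb : set U := xget set0 is_orthonormal_basis.

(* The trace of a nonnegative operator. *)
Definition trace (T : U -> U) : \bar R :=
  \esum_(e in onb) (dotp e (T e))%:E.

Definition hs_norm2 (T : U -> V) : \bar R :=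
  \esum_(e in onb) (`|T e| ^+ 2)%:E.

End operators.

Arguments onb {R U}.

Section functional_calculus.
Context (R : realType) (H : hilbertType R).

Definition op_poly (q : {poly R}) (T : H -> H) (x : H) : H :=
  \sum_(i < size q) q`_i *: iter i T x.

(* F = f(T) for T bounded, self-adjoint and nonnegative (hence with spectrum in
   [0, ||T||]) and f continuous on [0, ||T||]: the continuous functional
   calculus, by uniform polynomial approximation of f. *)
Definition is_fun_calc (T : H -> H) (f : R -> R) (F : H -> H) : Prop :=
  exists q : nat -> {poly R},
    {uniform `[0, fine (opnorm T)], (fun n => horner (q n)) @ \oo --> f} /\
    (fun n => opnorm (fun x => op_poly (q n) T x - F x)) @ \oo --> 0%E.

Definition op_exp (T : H -> H) (x : H) : H :=
  limn (series (fun k => (k`!%:R)^-1 *: iter k T x)).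

(* The integral over [a, b] of an operator-valued function, in the strong
   sense; the integral of the vector-valued function s |-> F s x is the Pettis
   one, which is the Bochner or Riemann integral for continuous integrands. *)
Definition op_integral (a b : R) (F : R -> H -> H) (x : H) : H :=
  xget 0 [set v | forall y,
    lebesgue_measure.-integrable `[a, b] (fun s => (dotp (F s x) y)%:E) /\
    dotp v y = \int[lebesgue_measure]_(s in `[a, b]) dotp (F s x) y].

(* Index functions on (0, oo), with the convention phi 0 = 0. *)
Record index_function (phi : R -> R) : Prop := {
  index_gt0 : forall l, 0 < l -> 0 < phi l ;
  index_nondecreasing : forall l l', 0 < l -> l <= l' -> phi l <= phi l' ;
  index_continuous : forall l, 0 < l -> {for l, continuous phi} ;
  index_cvg0 : phi x @[x --> 0^'+] --> 0 ;
  index_at0 : phi 0 = 0 }.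

(* A_phi = {x : x = phi(T) v, ||v|| <= 1}. *)
Definition source_set (T : H -> H) (phi : R -> R) : set H :=
  [set x | exists F : H -> H, is_fun_calc T phi F /\
           exists v, `|v| <= 1 /\ x = F v].

(* tr ((eps I + T)^{-1} T), with T = B^*B. *)
Definition effective_dimension (T : H -> H) (eps : R) : \bar R :=
  trace (fun x => op_inv setT (fun u => eps *: u + T u) (T x)).

End functional_calculus.

Section wiener.
Context (R : realType) (d : measure_display) (Om : measurableType d).
Context (P : probability Om R).

(* normal_prob m 0 is not the point mass at m, whence the case distinction. *)
Definition gaussian (Z : Om -> R) : Prop :=
  exists m s : R,
    if s == 0 then {ae P, forall w, Z w = m}
    else forall A : set R, measurable A -> P (Z @^-1` A) = normal_prob m s A.

(* Standard cylindrical Wiener process on Y over the time interval [0, T],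
   as a centred Gaussian family W_t(y) with covariance min(s,t) <y,y'> and
   almost surely continuous paths. W_0 = 0, linearity of W_t(y) in y and
   independence of the increments (all almost surely) follow. *)
Record cylindrical_wiener (Y : hilbertType R) (T : R)
    (W : R -> Y -> {RV P >-> R}) : Prop := {
  wiener_gaussian : forall n (a t : 'I_n -> R) (y : 'I_n -> Y),
    (forall i, 0 <= t i <= T) ->
    gaussian (fun w => \sum_(i < n) a i * W (t i) (y i) w) ;
  wiener_mean : forall t y, 0 <= t <= T -> ('E_P[W t y] = 0)%E ;
  wiener_covariance : forall s t y y', 0 <= s <= T -> 0 <= t <= T ->
    ('E_P[fun w => (W s y w * W t y' w)%R] = (Num.min s t * dotp y y')%:E)%E ;
  wiener_continuous : forall y,
    {ae P, forall w, {within `[0, T], continuous (fun t => W t y w)}} }.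

Definition random_element (X : topologicalType) (Z : Om -> X) : Prop :=
  forall A : set X, open A -> measurable (Z @^-1` A).

Context (X Y : hilbertType R).

(* The integrand s |-> 1_(lo, hi](s) <dir, .> val, with values in the rank one
   operators from Y to X. *)
Record piece := Piece { lo : R ; hi : R ; dir : Y ; val : X }.

Definition elementary (l : seq piece) (s : R) (y : Y) : X :=
  \sum_(k <- l) (\1_(`]lo k, hi k]) s * dotp (dir k) y) *: val k.

Definition elementary_integral (W : R -> Y -> {RV P >-> R}) (l : seq piece)
    (w : Om) : X :=
  \sum_(k <- l) (W (hi k) (dir k) w - W (lo k) (dir k) w) *: val k.

(* J = int_0^t Psi(s) dW(s) for a deterministic Psi in L^2(0, t; HS(Y, X)):
   the L^2(P; X) limit of the integrals of elementary integrands which tend to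
   Psi in L^2(0, t; HS(Y, X)). *)
Definition is_wiener_integral (W : R -> Y -> {RV P >-> R}) (t : R)
    (Psi : R -> Y -> X) (J : Om -> X) : Prop :=
  random_element J /\
  exists l : nat -> seq piece,
    [/\ forall n, seq.all (fun k => [&& 0 <= lo k, lo k <= hi k & hi k <= t]) (l n),
        (fun n => \int[lebesgue_measure]_(s in `[0%R, t])
            hs_norm2 (fun y => (elementary (l n) s y - Psi s y)%R))%E
          @ \oo --> 0%E
      & (fun n => 'E_P[fun w => (`|J w - elementary_integral W (l n) w| ^+ 2)%R])%E
          @ \oo --> 0%E ].

End wiener.

Section arm.
Context (R : realType) (X Y : hilbertType R).

(* C(s) = (C0^{-1} + s T)^{-1}, the domain of C0^{-1} being the range of C0. *)
Definition arm_cov (C0 T : X -> X) (s : R) : X -> X :=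
  op_inv (range C0) (fun u => op_inv setT C0 u + s *: T u).

(* exp (- int_a^b C(s) T ds) *)
Definition arm_flow (C0 T : X -> X) (a b : R) : X -> X :=
  op_exp (fun x => - op_integral a b (fun s => arm_cov C0 T s \o T) x).

(* m is the non-stationary ARM process on [0, T] with initial mean m0 and
   initial covariance C0 for exact solution u: the mild solution of
   dm = C(t) K^* (K (u - m) dt + dW), obtained by inserting
   dz = A u dt + Sigma^{1/2} dW with A = Sigma^{1/2} K. *)
Definition is_arm (d : measure_display) (Om : measurableType d)
    (P : probability Om R) (W : R -> Y -> {RV P >-> R}) (T : R)
    (K : X -> Y) (C0 : X -> X) (m0 u : X) (m : R -> Om -> X) : Prop :=
  let KK := adjoint K \o K in
  forall t, 0 <= t <= T ->
    random_element (m t) /\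
    exists J : Om -> X,
      is_wiener_integral W t
        (fun s => arm_flow C0 KK s t \o arm_cov C0 KK s \o adjoint K) J /\
      {ae P, forall w, u - m t w = arm_flow C0 KK 0 t (u - m0) - J w}.

End arm.

(* Main.v *)
Require Import Defs.
From mathcomp Require Import all_boot all_order all_algebra.
From mathcomp Require Import all_classical all_reals all_analysis.
From mathcomp Require Import measurable_realfun ring lra.
Set Implicit Arguments.
Unset Strict Implicit.
Unset Printing Implicit Defensive.

Import Order.TTheory GRing.Theory Num.Theory.
Import numFieldNormedType.Exports.

Local Open Scope classical_set_scope.
Local Open Scope ring_scope.

(** Everything is diagonal in one basis. Write K' for the adjoint of K and
    T = K' K. Since Omega = T^p has a finite trace, its square root is
    Hilbert-Schmidt, and this compactness passes back to T through the
    functional calculus: along a sequence x_n of the unit ball with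
    T x_n - t x_n -> 0, also Omega x_n - t^p x_n -> 0, so x_n has a limit along
    an ultrafilter, which is an eigenvector of T. Hence [spectral_theorem]: T
    has a total orthonormal sequence of eigenvectors v_i, with eigenvalues l_i.

    In this basis, with s_i = l_i^(p+1), the operators Omega, B' B and C(s)
    have the eigenvalues l_i^p, s_i and l_i^p / (alpha + s s_i). Those of
    C(s) T are the logarithmic derivatives of alpha + s s_i, so the flow from
    time a to time b has the eigenvalues
    (alpha + a s_i) / (alpha + b s_i) ([diagonal_arm_flow]). Two consequences
    carry the proof. The noise integrand, the flow from s to t composed with
    C(s) K', does not depend on s: it is C(t) K' ([arm_integrand_const]). The
    deterministic part of the error has, up to sign, the coefficients
    alpha / (alpha + t s_i) phi(l_i) <w, v_i> with |w| <= 1.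

    By the Ito isometry, the mean square error is at most the squared norm of
    the deterministic part plus t times the squared Hilbert-Schmidt norm of
    C(t) K' ([wiener_integral_le]). By Parseval the second term is the sum
    over i of t (l_i^p / (alpha + t s_i))^2 l_i. One factor
    l_i^p / (alpha + t s_i) is at most the constant in front of the effective
    dimension ([variance_scalar]); what remains is the i-th term
    s_i / (alpha / t + s_i) of the effective dimension itself
    ([arm_noise_le]).

    For the first term it is enough to bound alpha / (alpha + t s) phi(l),
    where s = l^(p+1), for all l in [0, 1] ([arm_error_le]). In part 1 one
    distinguishes whether s is below or above alpha / t ([bias_scalar]). In
    part 2, phi(l) <= c l^(p+1) extends from small l to [0, 1]
    ([index_le_powR]) and gives the bound c alpha / t. *)

(** * Inner products and limits *)

Local Notation "''[' u , v ]" := (dotp u%R v%R) : ring_scope.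

Section dot_basics.
Context (R : realType) (H : hilbertType R).
Implicit Types x y z : H.

Lemma dotC x y : '[x, y] = '[y, x].
Proof. by rewrite hermC expr0 mul1r. Qed.

Lemma dotDl x y z : '[x + y, z] = '[x, z] + '[y, z].
Proof. exact: linearDl. Qed.

Lemma dotDr x y z : '[x, y + z] = '[x, y] + '[x, z].
Proof. exact: linearDr. Qed.

Lemma dotNl x y : '[- x, y] = - '[x, y].
Proof. exact: linearNl. Qed.

Lemma dotNr x y : '[x, - y] = - '[x, y].
Proof. exact: linearNr. Qed.

Lemma dotBl x y z : '[x - y, z] = '[x, z] - '[y, z].
Proof. by rewrite dotDl dotNl. Qed.

Lemma dotBr x y z : '[x, y - z] = '[x, y] - '[x, z].
Proof. by rewrite dotDr dotNr. Qed.

Lemma dotZl a x y : '[a *: x, y] = a * '[x, y].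
Proof. exact: linearZl_LR. Qed.

Lemma dotZr a x y : '[x, a *: y] = a * '[x, y].
Proof. by rewrite dotC dotZl dotC. Qed.

Lemma dot0l x : '[0, x] = 0.
Proof. exact: linear0l. Qed.

Lemma dot0r x : '[x, 0] = 0.
Proof. exact: linear0r. Qed.

Lemma dot_suml I (s : seq I) (P : pred I) (F : I -> H) x :
  '[\sum_(i <- s | P i) F i, x] = \sum_(i <- s | P i) '[F i, x].
Proof. by rewrite linear_sumlz. Qed.

Lemma dot_sumr I (s : seq I) (P : pred I) (F : I -> H) x :
  '[x, \sum_(i <- s | P i) F i] = \sum_(i <- s | P i) '[x, F i].
Proof. by rewrite linear_sumr. Qed.

Lemma normB_sqr x y : `|x - y| ^+ 2 = `|x| ^+ 2 - '[x, y] *+ 2 + `|y| ^+ 2.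
Proof.
rewrite -!dotp_norm dotBl !dotBr (dotC y x); ring.
Qed.

Lemma normD_sqr x y : `|x + y| ^+ 2 = `|x| ^+ 2 + '[x, y] *+ 2 + `|y| ^+ 2.
Proof. by rewrite -[y in LHS]opprK normB_sqr dotNr normrN mulNrn opprK. Qed.

Lemma cauchy_schwarz x y : `|'[x, y]| <= `|x| * `|y|.
Proof.
have [->|x0] := eqVneq x 0; first by rewrite dot0l !normr0 mul0r.
have xg : 0 < `|x| ^+ 2 by rewrite exprn_gt0// normr_gt0.
have : 0 <= `| `|x| ^+ 2 *: y - '[x, y] *: x| ^+ 2 by rewrite sqr_ge0.
rewrite normB_sqr !normrZ !exprMn dotZl dotZr (dotC y) !real_normK ?num_real//.
have -> : (`|x| ^+ 2) ^+ 2 * `|y| ^+ 2 - (`|x| ^+ 2 * ('[x, y] * '[x, y])) *+ 2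
   + '[x, y] ^+ 2 * `|x| ^+ 2 =
   `|x| ^+ 2 * (`|x| ^+ 2 * `|y| ^+ 2 - '[x, y] ^+ 2) by ring.
rewrite pmulr_rge0// subr_ge0 -exprMn => h.
by rewrite -(@ler_pXn2r _ 2) ?nnegrE ?mulr_ge0// real_normK ?num_real.
Qed.

(** Young form of the triangle inequality: as [d] tends to 0 the weight of [x]
    tends to 1, so that a negligible [y] costs nothing in a sharp bound. *)
Lemma norm_sqrD_le (d : R) x y : 0 < d ->
  `|x + y| ^+ 2 <= (1 + d) * `|x| ^+ 2 + (1 + d^-1) * `|y| ^+ 2.
Proof.
move=> d0; rewrite normD_sqr.
have : '[x, y] *+ 2 <= d * `|x| ^+ 2 + d^-1 * `|y| ^+ 2; last by lra.
apply: (@le_trans _ _ ((`|x| * `|y|) *+ 2)).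
  by rewrite lerMn2r (le_trans (ler_norm _) (cauchy_schwarz _ _)).
rewrite -subr_ge0.
have -> : d * `|x| ^+ 2 + d^-1 * `|y| ^+ 2 - (`|x| * `|y|) *+ 2 =
  d^-1 * (d * `|x| - `|y|) ^+ 2.
  by field; rewrite gt_eqF.
by rewrite mulr_ge0 ?invr_ge0 ?sqr_ge0 ?ltW.
Qed.

Lemma dot_eq x y : (forall z, '[x, z] = '[y, z]) -> x = y.
Proof.
move=> h; apply/eqP; rewrite -subr_eq0 -normr_eq0 -sqrf_eq0 -dotp_norm.
by rewrite dotBl h subrr.
Qed.

End dot_basics.

Section continuity.
Context (R : realType).

Lemma lipschitz_continuous (U V : normedModType R) (f : U -> V) (M : R) :
  (forall x y, `|f x - f y| <= M * `|x - y|) -> continuous f.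
Proof.
move=> fM x; apply/cvgrPdist_le => e e0.
have M0 : 0 < `|M| + 1 by rewrite ltr_wpDl.
near=> y; apply: (le_trans (fM _ _)).
apply: (@le_trans _ _ ((`|M| + 1) * `|x - y|)).
  by rewrite ler_wpM2r// (le_trans (ler_norm _))// lerDl.
rewrite mulrC -ler_pdivlMr//; near: y.
by apply: cvgr_dist_le => //; rewrite divr_gt0.
Unshelve. all: by end_near. Qed.

Lemma continuous_cvg_comp (U V : topologicalType) (f : U -> V) T
  (F : set_system T) {FF : Filter F} (g : T -> U) a :
  continuous f -> g @ F --> a -> (fun t => f (g t)) @ F --> f a.
Proof. by move=> cf ga; apply: (@cvg_comp _ _ _ _ f _ _ _ ga); exact: cf. Qed.

Lemma cvg_eq_lim (V : normedModType R) T (F : set_system T) {FF : ProperFilter F}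
  (f g : T -> V) (a b : V) : f @ F --> a -> g @ F --> b -> f =1 g -> a = b.
Proof. by move=> fa gb /funext fg; rewrite fg in fa; exact: (cvg_unique _ fa gb). Qed.

Lemma cvg_scale (V : normedModType R) T (F : set_system T) {FF : Filter F}
  (c : R) (f : T -> V) (a : V) : f @ F --> a -> (fun t => c *: f t) @ F --> c *: a.
Proof. exact: cvgZr. Qed.

Lemma cvgZ0 (V : normedModType R) T (F : set_system T) {FF : Filter F}
  (c : R) (f : T -> V) : f @ F --> 0 -> (fun t => c *: f t) @ F --> 0.
Proof. by move=> f0; rewrite -(scaler0 V c); exact: cvg_scale. Qed.

Lemma cvg_bigsum (V : normedModType R) T (F : set_system T) {FF : Filter F}
  J (s : seq J) (f : J -> T -> V) (l : J -> V) :
  (forall j, f j @ F --> l j) ->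
  (fun t => \sum_(j <- s) f j t) @ F --> \sum_(j <- s) l j.
Proof.
move=> fl; elim: s => [|j s IH].
  rewrite big_nil (_ : (fun t => _) = cst 0); first exact: cvg_cst.
  by apply/funext => t; rewrite big_nil.
rewrite big_cons (_ : (fun t => _) = (fun t => f j t + \sum_(k <- s) f k t)).
  exact: cvgD.
by apply/funext => t; rewrite big_cons.
Qed.

Lemma cvg_dotl (H : hilbertType R) T (F : set_system T) {FF : Filter F}
  (f : T -> H) x y :
  f @ F --> x -> (fun t => '[f t, y]) @ F --> '[x, y].
Proof.
move=> fx; have cy : continuous (fun x : H => '[x, y] : R^o).
  apply: (@lipschitz_continuous _ _ _ `|y|) => a b.
  by rewrite -dotBl mulrC cauchy_schwarz.
apply: (@cvg_comp _ _ _ f (fun x : H => '[x, y]) F (nbhs x)) => //; exact: cy.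
Qed.

Lemma cvg_dot (H : hilbertType R) T (F : set_system T) {FF : Filter F}
  (f g : T -> H) x y : f @ F --> x -> g @ F --> y ->
  (fun t => '[f t, g t]) @ F --> '[x, y].
Proof.
move=> fx gy.
have -> : (fun t => '[f t, g t]) =
    (fun t => (`|f t + g t| ^+ 2 - `|f t| ^+ 2 - `|g t| ^+ 2) / 2).
  by apply/funext => t; rewrite normD_sqr; field.
have -> : '[x, y] = (`|x + y| ^+ 2 - `|x| ^+ 2 - `|y| ^+ 2) / 2.
  by rewrite normD_sqr; field.
have sq (h : T -> H) z : h @ F --> z -> (fun t => `|h t| ^+ 2) @ F --> `|z| ^+ 2.
  by move=> hz; rewrite expr2; apply: cvgM; apply: cvg_norm.
apply: cvgMl; apply: cvgB; first apply: cvgB; apply: sq => //.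
exact: cvgD.
Qed.

End continuity.

(** * Fourier expansions *)

(** Allowing zero entries lets a sequence indexed by [nat] enumerate finite
    orthonormal families as well. *)
Record ortho_seq (R : realType) (H : hilbertType R) (v : nat -> H) : Prop := {
  ortho_seq_dot : forall i j, i != j -> '[v i, v j] = 0 ;
  ortho_seq_norm : forall i, v i = 0 \/ `|v i| = 1 }.

Definition total_seq (R : realType) (H : hilbertType R) (v : nat -> H) :=
  forall x, (forall i, '[x, v i] = 0) -> x = 0.

Section fourier.
Context (R : realType) (H : hilbertType R) (v : nat -> H).
Hypothesis vO : ortho_seq v.
Implicit Types (x y z : H) (a b : nat -> R) (M : R).

Let fsum a m n := \sum_(m <= k < n) a k *: v k.

Lemma ortho_seq_sq j : '[v j, v j] = 1 \/ v j = 0.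
Proof.
by case: (ortho_seq_norm vO j) => h; [right|left; rewrite dotp_norm h expr1n].
Qed.

(** The coefficients of a sum along [v] carry a factor [<v j, v j>], which is 0
    on the zero entries; Fourier coefficients absorb it. *)
Lemma coef_idem x j : '[x, v j] * '[v j, v j] = '[x, v j].
Proof.
by case: (ortho_seq_sq j) => ->; rewrite ?mulr1// !dot0r mul0r.
Qed.

Lemma dot_fsum a m n j :
  '[fsum a m n, v j] = (m <= j < n)%N%:R * (a j * '[v j, v j]).
Proof.
rewrite /fsum dot_suml; case: (boolP (m <= j < n)%N) => jmn; rewrite ?mul1r ?mul0r.
  rewrite (bigD1_seq j) ?mem_index_iota ?iota_uniq//= dotZl.
  by rewrite big1 ?addr0// => i ij; rewrite dotZl (ortho_seq_dot vO)// mulr0.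
rewrite big_seq big1// => i; rewrite mem_index_iota => imn.
rewrite dotZl (ortho_seq_dot vO) ?mulr0//.
by apply: contraNneq jmn => <-.
Qed.

Lemma norm_fsum a m n :
  `|fsum a m n| ^+ 2 = \sum_(m <= k < n) a k ^+ 2 * '[v k, v k].
Proof.
rewrite -dotp_norm {2}/fsum dot_sumr !big_seq; apply: eq_bigr => i.
by rewrite mem_index_iota => imn; rewrite dotZr dot_fsum imn mul1r mulrA.
Qed.

Lemma norm_fsum_le a m n :
  `|fsum a m n| ^+ 2 <= \sum_(m <= k < n) a k ^+ 2.
Proof.
rewrite norm_fsum; apply: ler_sum => i _.
by case: (ortho_seq_sq i) => ->; rewrite ?mulr1// dot0l mulr0 sqr_ge0.
Qed.

Lemma norm_sub_fsum x n :
  `|x - fsum (fun k => '[x, v k]) 0 n| ^+ 2 =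
  `|x| ^+ 2 - \sum_(0 <= k < n) '[x, v k] ^+ 2.
Proof.
rewrite normB_sqr norm_fsum {1}/fsum dot_sumr.
under eq_bigr do rewrite dotZr -expr2.
under [in X in _ + X]eq_bigr do rewrite expr2 -mulrA coef_idem -expr2.
ring.
Qed.

Lemma bessel x n : \sum_(0 <= k < n) '[x, v k] ^+ 2 <= `|x| ^+ 2.
Proof. by rewrite -subr_ge0 -norm_sub_fsum sqr_ge0. Qed.

(** The partial sums are Cauchy because their increments are bounded by those
    of a bounded, nondecreasing series of reals. *)
Lemma riesz_fischer a M : (forall n, \sum_(0 <= k < n) a k ^+ 2 <= M) ->
  cvgn (series (fun k => a k *: v k)).
Proof.
move=> aM; apply/cauchy_cvgP/cauchy_seriesP => e e0.
have : cvgn (series (fun k => a k ^+ 2)).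
  apply: nondecreasing_is_cvgn; last by exists M => _ [n _ <-]; exact: aM.
  apply/nondecreasing_seqP => n.
  by rewrite /series/= big_nat_recr//= lerDl sqr_ge0.
move=> /cauchy_cvgP/cauchy_seriesP/(_ (e ^+ 2)).
rewrite exprn_gt0// => /(_ isT); apply: filterS => -[m n]/= h.
rewrite -(@ltr_pXn2r _ 2) ?nnegrE ?normr_ge0 ?(ltW e0)//.
apply: le_lt_trans h; apply: (le_trans (norm_fsum_le _ _ _)).
exact: ler_norm.
Qed.

Lemma cvg_coef a M : (forall n, \sum_(0 <= k < n) a k ^+ 2 <= M) ->
  forall j, '[limn (series (fun k => a k *: v k)), v j] = a j * '[v j, v j].
Proof.
move=> aM j; rewrite -(cvg_lim _ (cvg_dotl (y := v j) (riesz_fischer aM)))//.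
 apply: cvg_lim => //; apply: cvg_near_cst.
by exists j.+1 => // n /= jn; rewrite /series/= dot_fsum jn mul1r.
Qed.


(** The operator with the eigenvalues [a i] on [v i], for bounded [a]. *)
Definition fourier_diag a x := limn (series (fun k => (a k * '[x, v k]) *: v k)).

Lemma fourier_diag_bound a M : (forall i, `|a i| <= M) ->
  forall x n, \sum_(0 <= k < n) (a k * '[x, v k]) ^+ 2 <= M ^+ 2 * `|x| ^+ 2.
Proof.
move=> aM x n; apply: (@le_trans _ _ (\sum_(0 <= k < n) M ^+ 2 * '[x, v k] ^+ 2)).
  apply: ler_sum => k _; rewrite exprMn ler_wpM2r ?sqr_ge0//.
  by rewrite -(@real_normK _ (a k)) ?num_real// lerXn2r ?nnegrE ?(le_trans _ (aM k)).
by rewrite -mulr_sumr ler_wpM2l ?sqr_ge0// bessel.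
Qed.

Lemma dot_fourier_diag a M : (forall i, `|a i| <= M) ->
  forall x j, '[fourier_diag a x, v j] = a j * '[x, v j].
Proof.
move=> aM x j; rewrite (cvg_coef (fourier_diag_bound aM x)).
by rewrite -mulrA coef_idem.
Qed.

Section total.
Hypothesis vT : total_seq v.

Lemma coef_inj x y : (forall i, '[x, v i] = '[y, v i]) -> x = y.
Proof.
by move=> xy; apply/eqP; rewrite -subr_eq0; apply/eqP/vT => i; rewrite dotBl xy subrr.
Qed.

Lemma cvg_fourier x : series (fun k => '[x, v k] *: v k) @ \oo --> x.
Proof.
have cx := riesz_fischer (bessel x).
suff e : limn (series (fun k => '[x, v k] *: v k)) = x by rewrite -[X in _ --> X]e.
by apply: coef_inj => i; rewrite (cvg_coef (bessel x)) coef_idem.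
Qed.

Lemma cvg_parseval_dot x y :
  series (fun k => '[x, v k] * '[y, v k]) @ \oo --> '[x, y].
Proof.
apply: cvg_trans (cvg_dotl (y := y) (@cvg_fourier x)).
apply: near_eq_cvg; near=> n.
rewrite /series/= dot_suml; apply: eq_bigr => i _.
by rewrite dotZl (dotC y).
Unshelve. all: by end_near. Qed.

Lemma parseval x : (`|x| ^+ 2)%:E = (\sum_(0 <= k <oo) ('[x, v k] ^+ 2)%:E)%E.
Proof.
apply/esym/cvg_lim => //; rewrite -dotp_norm.
under eq_cvg do rewrite sumEFin.
apply/fine_cvgP; split; first by near=> n.
have := @cvg_parseval_dot x x; apply: cvg_trans; apply: near_eq_cvg; near=> n.
by rewrite /series/=; apply: eq_bigr => i _; rewrite expr2.
Unshelve. all: by end_near. Qed.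

(** Norm inequalities are checked coefficientwise, by Parseval. *)
Lemma norm_sqr_le_coef x y M :
  (forall i, '[x, v i] ^+ 2 <= M * '[y, v i] ^+ 2) ->
  `|x| ^+ 2 <= M * `|y| ^+ 2.
Proof.
move=> xy; rewrite -!dotp_norm.
have cy : (fun n => M * series (fun k => '[y, v k] * '[y, v k]) n) @ \oo --> M * '[y, y].
  by apply: cvgMr; exact: cvg_parseval_dot.
rewrite -(cvg_lim _ (@cvg_parseval_dot x x))// -(cvg_lim _ cy)//.
apply: ler_lim; [exact: cvgP (@cvg_parseval_dot x x)|exact: cvgP cy|].
apply: nearW => n; rewrite /series/= mulr_sumr; apply: ler_sum => i _.
by rewrite -!expr2.
Qed.

(** The representing vector has the coordinates [f (v i)]: evaluating [f] at
    the partial sums of its expansion bounds the sum of squares by [M ^+ 2]. *)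
Lemma riesz_representation (f : H -> R) M :
  (forall x y, f (x + y) = f x + f y) -> (forall c x, f (c *: x) = c * f x) ->
  (forall x, `|f x| <= M * `|x|) -> exists z, forall x, f x = '[x, z].
Proof.
move=> fD fZ fM.
have f0 : f 0 = 0 by rewrite -(scale0r 0) fZ mul0r.
have fS (a : nat -> R) n : f (fsum a 0 n) = \sum_(0 <= k < n) a k * f (v k).
  rewrite /fsum (big_morph f fD f0); apply: eq_bigr => i _; exact: fZ.
have M0 : 0 <= M \/ forall x, f x = 0.
  have [|M0] := leP 0 M; [by left|right => x].
  apply/eqP; rewrite -normr_le0 (le_trans (fM x))//.
  by rewrite nmulr_rle0.
case: M0 => [M0|fz]; last by exists 0 => x; rewrite dot0r.
have aM n : \sum_(0 <= k < n) f (v k) ^+ 2 <= M ^+ 2.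
  set s := \sum_(0 <= k < n) _.
  have s0 : 0 <= s by apply: sumr_ge0 => i _; exact: sqr_ge0.
  have : s ^+ 2 <= M ^+ 2 * s.
    have {1}-> : s = f (fsum (f \o v) 0 n).
      by rewrite fS /s; apply: eq_bigr => i _; rewrite expr2.
    rewrite -real_normK ?num_real//.
    apply: (@le_trans _ _ ((M * `|fsum (f \o v) 0 n|) ^+ 2)).
      by rewrite lerXn2r ?nnegrE ?mulr_ge0.
    by rewrite exprMn ler_wpM2l ?sqr_ge0// norm_fsum_le.
  have [->|sn0] := eqVneq s 0; first by rewrite sqr_ge0.
  by rewrite expr2 ler_pM2r// lt_def sn0.
exists (limn (series (fun k => f (v k) *: v k))) => x.
set z := limn _.
have vz i : '[v i, z] = f (v i) * '[v i, v i] by rewrite dotC (cvg_coef aM).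
have c1 : (fun n => f (series (fun k => '[x, v k] *: v k) n)) @ \oo --> f x.
  have cf : continuous (f : H -> R^o).
    apply: (@lipschitz_continuous _ _ _ _ M) => a b.
    by rewrite -[- f b]mulN1r -fZ -fD scaleN1r.
  by apply: (@cvg_comp _ _ _ _ f _ _ _ (@cvg_fourier x)); exact: cf.
have c2 := cvg_dotl (y := z) (@cvg_fourier x).
have e : (fun n => f (series (fun k => '[x, v k] *: v k) n)) =
         (fun n => '[series (fun k => '[x, v k] *: v k) n, z]).
  apply/funext => n; rewrite /series/= fS dot_suml; apply: eq_bigr => i _.
  by rewrite dotZl vz mulrCA coef_idem mulrC.
by rewrite e in c1; apply: (cvg_unique _ c1 (c2 _)).
Qed.

End total.
End fourier.

(** * Orthonormal bases and adjoints *)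

Definition orthonormal_set (R : realType) (H : hilbertType R) (E : set H) :=
  forall e f, E e -> E f -> '[e, f] = (e == f)%:R.

Section orthonormal_sets.
Context (R : realType) (H : hilbertType R).
Implicit Types (E Q : set H) (x y : H).

(** Zorn's lemma inside a class [Q] of vectors: all of them for the existence of
    a basis, the eigenvectors of an operator for the spectral theorem. *)
Lemma maximal_orthonormal Q : exists E, [/\ E `<=` Q, orthonormal_set E &
  forall x, Q x -> `|x| = 1 -> (forall e, E e -> '[x, e] = 0) -> False].
Proof.
pose P E := E `<=` Q /\ orthonormal_set E.
have PU (F : set (set H)) : F `<=` P -> total_on F subset -> P (\bigcup_(X in F) X).
  move=> FP tF; split; first by move=> x [E /FP[EQ _] /EQ].
  move=> e f [E FE Ee] [G FG Gf].
  have [EG|GE] := tF E G FE FG; first by apply: (FP G FG).2 => //; exact: EG.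
  by apply: (FP E FE).2 => //; exact: GE.
have [E [[EQ EO] Emax]] := Zorn_bigcup PU.
exists E; split=> // x Qx x1 xE.
have nEx : ~ E x.
  by move=> /xE; rewrite dotp_norm x1 expr1n => /eqP; rewrite oner_eq0.
apply: (Emax (E `|` [set x])).
  split; first exact: subsetUl.
  by move=> /(_ x) h; apply: nEx; apply: h; right.
split; first by move=> z [/EQ//|->].
move=> e f [Ee|->] [Ef|->]; first exact: EO.
- rewrite dotC xE//; case: eqP => // ex; by rewrite ex in Ee.
- rewrite xE//; case: eqP => // ex; by rewrite -ex in Ef.
- by rewrite dotp_norm x1 expr1n eqxx.
Qed.

(** Distinct elements of [E] are at distance sqrt 2, so they cannot share a point
    of a countable dense set within distance 1/2. *)
Lemma orthonormal_countable E : separable H -> orthonormal_set E -> countable E.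
Proof.
move=> [S [/countable_injP[g gI] Sd]] EO; apply/countable_injP.
have ex (e : H) : exists s, S s /\ `|e - s| < 2^-1.
  have [] := Sd (ball e 2^-1).
  - by exists e; apply: ballxx; rewrite invr_gt0.
  - exact: ball_open.
  - by move=> s []; rewrite -ball_normE => bs Ss; exists s; split.
have /choice[s sP] := ex; exists (g \o s) => e f.
rewrite !inE => Ee Ef /= /gI; rewrite !inE => h.
have {}h := h (sP e).1 (sP f).1.
apply/eqP/negPn/negP => ef.
have : `|e - f| ^+ 2 = 2.
  by rewrite normB_sqr -!dotp_norm !EO// (negbTE ef) !eqxx mul0rn subr0.
have : `|e - f| < 1.
  rewrite [ltRHS]splitr (le_lt_trans (ler_distD (s e) e f))// ltrD ?(sP _).2//.
    by rewrite mul1r (sP _).2.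
  by rewrite distrC h mul1r (sP _).2.
move=> h1 h2; have : `|e - f| ^+ 2 < 1 by rewrite expr_lt1.
by rewrite h2; lra.
Qed.

(** Indices outside the range of the numbering of [E] are sent to 0, so a
    function vanishing at 0 has the same sum over [E] and along [v]. *)
Lemma orthonormal_enum E : countable E -> orthonormal_set E ->
  exists v : nat -> H, [/\ ortho_seq v, forall i, v i = 0 \/ E (v i),
    forall e, E e -> exists i, v i = e &
    forall f : H -> \bar R, (forall x, (0 <= f x)%E) -> f 0 = 0%E ->
      (\esum_(e in E) f e = \sum_(0 <= i <oo) f (v i))%E].
Proof.
move=> /countable_injP[g gI] EO.
pose v n := xget 0 [set e | E e /\ g e = n].
have vP n : v n = 0 \/ (E (v n) /\ g (v n) = n).
  by rewrite /v; case: xgetP => [x _ h|]; [right|left].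
have gv e : E e -> v (g e) = e.
  move=> Ee; rewrite /v; case: xgetP => [x _ [Ex gx]|]; last by move/(_ e); case.
  by apply: gI; rewrite ?inE.
have E0 : ~ E 0.
  by move=> E0; have := EO _ _ E0 E0; rewrite dot0l eqxx => /eqP; rewrite eq_sym oner_eq0.
exists v; split.
- split=> [i j ij|i].
    case: (vP i) => [->|[Ei gi]]; first by rewrite dot0l.
    case: (vP j) => [->|[Ej gj]]; first by rewrite dot0r.
    rewrite EO//; case: eqP => // vij; move: ij.
    by rewrite -gi -gj vij eqxx.
  case: (vP i) => [->|[Ei gi]]; [by left|right].
  by apply/eqP; rewrite -(@pexpr_eq1 _ _ 2)// -dotp_norm EO// eqxx.
- by move=> i; case: (vP i) => [|[]]; [left|right].
- by move=> e Ee; exists (g e); exact: gv.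
move=> f f0 f00; rewrite nneseries_esumT//.
rewrite (reindex_esum (g @` E) E v); last first.
  split=> /=.
  - by move=> _ [e Ee <-]; rewrite gv.
  - move=> _ _ /set_mem[e Ee <-] /set_mem[h Eh <-]; by rewrite !gv// => ->.
  - by move=> e Ee; exists (g e); [exists e|exact: gv].
rewrite esum_mkcond; apply: eq_esum => i _.
case: ifPn => // /negP iE; case: (vP i) => [->//|[Ei gi]].
by exfalso; apply: iE; rewrite inE; exists (v i).
Qed.

Lemma unit_scale x : x != 0 -> `| `|x|^-1 *: x| = 1.
Proof. by move=> x0; rewrite normrZ normfV normr_id mulVf// normr_eq0. Qed.

Lemma unit_scale_le1 x : x != 0 -> `| `|x|^-1 *: x| <= 1.
Proof. by move=> /unit_scale ->. Qed.

Lemma onb_exists : is_orthonormal_basis (onb : set H).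
Proof.
apply: xgetPex; have [E [_ EO Emax]] := maximal_orthonormal setT.
exists E; split=> // x xE; apply/eqP/negPn/negP => x0.
apply: (Emax (`|x|^-1 *: x)) => //; first exact: unit_scale.
by move=> e Ee; rewrite dotZl xE// mulr0.
Qed.

(** Traces and Hilbert-Schmidt norms are sums over [onb]; as series they are
    accessible to Parseval and to the exchange of double series. *)
Lemma onb_enum : separable H -> exists v : nat -> H,
  [/\ ortho_seq v, total_seq v &
    forall f : H -> \bar R, (forall x, (0 <= f x)%E) -> f 0 = 0%E ->
      (\esum_(e in onb) f e = \sum_(0 <= i <oo) f (v i))%E].
Proof.
move=> Hs; have [EO Et] := onb_exists.
have [v [vO vE Ev ve]] := orthonormal_enum (orthonormal_countable Hs EO) EO.
exists v; split=> // x vx; apply: Et => e /Ev[i <-]; exact: vx.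
Qed.

End orthonormal_sets.

Section adjoint.
Context (R : realType) (U V : hilbertType R) (U_sep : separable U).

(** The adjoint exists by Riesz representation of [u |-> <K u, y>]. *)
Lemma adjoint_dot (K : U -> V) M :
  (forall x y, K (x + y) = K x + K y) -> (forall c x, K (c *: x) = c *: K x) ->
  (forall x, `|K x| <= M * `|x|) ->
  forall u y, '[K u, y] = '[u, adjoint K y].
Proof.
move=> KD KZ KM u y.
have [v [vO vT _]] := onb_enum U_sep.
have [||x|z hz] := @riesz_representation _ _ v vO vT (fun u => '[K u, y]) (M * `|y|).
- by move=> a b; rewrite KD dotDl.
- by move=> c a; rewrite KZ dotZl.
- by rewrite (le_trans (cauchy_schwarz _ _))// mulrAC ler_wpM2r.
suff /(_ u) : [set x | forall u, '[K u, y] = '[u, x]] (adjoint K y) by [].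
by apply: xgetPex; exists z.
Qed.

End adjoint.

(** * Operator norm and functional calculus *)

Section bounded_operators.
Context (R : realType).

Lemma opnorm_ge (U V : normedModType R) (T : U -> V) x : `|x| <= 1 ->
  (`|T x|%:E <= opnorm T)%E.
Proof. by move=> x1; apply: ereal_sup_ubound; exists x. Qed.

Lemma opnorm_le (U V : normedModType R) (T : U -> V) (M : R) :
  (forall x, `|x| <= 1 -> `|T x| <= M) -> (opnorm T <= M%:E)%E.
Proof. by move=> TM; apply: ge_ereal_sup => _ [x x1 <-]; rewrite lee_fin TM. Qed.

Lemma opnorm_ge0 (U V : normedModType R) (T : U -> V) : (0 <= opnorm T)%E.
Proof.
by apply: (@le_trans _ _ `|T 0|%:E); [rewrite lee_fin|apply: opnorm_ge; rewrite normr0].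
Qed.

Lemma opnorm_bound (U V : normedModType R) (T : U -> V) (M : R) :
  (forall c x, T (c *: x) = c *: T x) -> (opnorm T <= M%:E)%E ->
  forall x, `|T x| <= M * `|x|.
Proof.
move=> TZ TM x; have [->|x0] := eqVneq x 0.
  by rewrite -(scale0r 0) TZ !scale0r !normr0 mulr0.
have nx : 0 < `|x| by rewrite normr_gt0.
rewrite -ler_pdivrMr//; have : (`|T (`|x|^-1 *: x)|%:E <= M%:E)%E.
  apply: le_trans TM; apply: opnorm_ge.
  by rewrite normrZ normfV normr_id mulVf ?gt_eqF.
by rewrite lee_fin TZ normrZ normfV normr_id mulrC.
Qed.

End bounded_operators.

Section functional_calculus_eigen.
Context (R : realType) (H : hilbertType R) (T : H -> H).
Hypothesis TD : forall x y, T (x + y) = T x + T y.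
Hypothesis TZ : forall c x, T (c *: x) = c *: T x.
Hypothesis T_le1 : forall x, `|T x| <= `|x|.
Hypothesis TS : self_adjoint T.
Implicit Types (q : {poly R}) (f : R -> R).

Lemma dot_op_poly q l v x : T v = l *: v -> '[op_poly q T x, v] = q.[l] * '[x, v].
Proof.
move=> Tv; rewrite /op_poly dot_suml horner_coef mulr_suml.
apply: eq_bigr => i _; rewrite dotZl -mulrA; congr (_ * _).
elim: (i : nat) => [|k IH]; first by rewrite expr0 mul1r.
by rewrite iterS TS Tv dotZr IH mulrA -exprS.
Qed.

Lemma fun_calc_approx f F : is_fun_calc T f F ->
  exists q : nat -> {poly R}, (forall l : R, 0 <= l <= fine (opnorm T) ->
      (fun n => (q n).[l]) @ \oo --> f l) /\
    forall e : R, 0 < e -> \forall n \near \oo, forall x, `|x| <= 1 ->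
      `|op_poly (q n) T x - F x| <= e.
Proof.
move=> [q [qf qF]]; exists q; split=> [l l01|e e0].
  have : {uniform [set l], (fun n => horner (q n)) @ \oo --> f}.
    by apply: (@uniform_subset_cvg _ _ _ _ [set l] _ _ _ qf) => _ /= ->; rewrite in_itv.
  by rewrite uniform_set1.
have /fine_cvgP[fi /cvgr0Pnorm_le/(_ _ e0) ne] := qF.
near=> n => x x1; rewrite -lee_fin.
have fn : opnorm (fun x => op_poly (q n) T x - F x) \is a fin_num by near: n.
apply: (le_trans (opnorm_ge (fun x => op_poly (q n) T x - F x) x1)).
rewrite -(fineK fn) lee_fin (le_trans (ler_norm _))//; near: n; exact: ne.
Unshelve. all: by end_near. Qed.

(** Polynomials in [T] act on an eigenvector through their value at the
    eigenvalue. The bound on [x] is there because [opnorm], a supremum over the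
    unit ball, says nothing about a nonlinear [F] outside of it. *)
Lemma dot_fun_calc f F l v x : is_fun_calc T f F -> T v = l *: v ->
  0 <= l <= fine (opnorm T) -> `|x| <= 1 -> '[F x, v] = f l * '[x, v].
Proof.
move=> /fun_calc_approx[q [qf qF]] Tv l01 x1.
have c1 : (fun n => (q n).[l] * '[x, v]) @ \oo --> f l * '[x, v].
  by apply: cvgMl; exact: qf.
have c2 : (fun n => op_poly (q n) T x) @ \oo --> F x.
  apply/cvgrPdist_le => e e0; have := qF _ e0; apply: filterS => n /(_ _ x1).
  by rewrite distrC.
have c3 := cvg_dotl (y := v) c2; apply: (cvg_unique _ (c3 _)) => //.
rewrite /= (_ : (fun n => _) = (fun n => (q n).[l] * '[x, v]))//.
by apply/funext => n; rewrite (dot_op_poly _ _ Tv).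
Qed.

(** Where [T] almost acts as [t], its iterates almost act as the powers of [t],
    hence polynomials in [T] as their values at [t], and so does their uniform
    limit. This is how compactness of [F] becomes available for [T]. *)
Lemma fun_calc_approx_eigen f F I (G : set_system I) {GF : ProperFilter G}
    (x : I -> H) (t : R) : is_fun_calc T f F ->
  (forall i, `|x i| <= 1) -> 0 <= t <= fine (opnorm T) ->
  (fun i => T (x i) - t *: x i) @ G --> 0 ->
  (fun i => F (x i) - f t *: x i) @ G --> 0.
Proof.
move=> /fun_calc_approx[q [qf qF]] x1 t01 Tx.
have T0 : T 0 = 0 by rewrite -(scale0r 0) TZ !scale0r.
have TB a b : T (a - b) = T a - T b by rewrite TD -scaleN1r TZ scaleN1r.
have Tc : continuous T.
  by apply: (@lipschitz_continuous _ _ _ _ 1) => a b; rewrite -TB mul1r.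
have Ti k : (fun i => iter k T (x i) - t ^+ k *: x i) @ G --> 0.
  elim: k => [|k IH].
    by rewrite (_ : (fun i => _) = cst 0)//; [exact: cvg_cst|apply/funext => i; rewrite expr0 scale1r subrr].
  rewrite (_ : (fun i => _) = (fun i => T (iter k T (x i) - t ^+ k *: x i) +
      t ^+ k *: (T (x i) - t *: x i))); last first.
    apply/funext => i; rewrite iterS TB TZ scalerBr scalerA addrA subrK.
    by rewrite exprSr.
  rewrite -[0]addr0; apply: cvgD.
    by have := continuous_cvg_comp Tc IH; rewrite T0; exact.
  exact: cvgZ0.
have qT (p : {poly R}) : (fun i => op_poly p T (x i) - p.[t] *: x i) @ G --> 0.
  rewrite (_ : (fun i => _) = (fun i => \sum_(k < size p)
     p`_k *: (iter k T (x i) - t ^+ k *: x i))); last first.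
    apply/funext => i; rewrite /op_poly horner_coef scaler_suml -sumrB.
    by apply: eq_bigr => k _; rewrite scalerBr scalerA.
  rewrite [X in _ --> X](_ : 0 = \sum_(k < size p) (0 : H)); last by rewrite big1.
  apply: (@cvg_bigsum _ _ _ _ _ _ _ (fun (k : 'I_(size p)) i =>
    p`_k *: (iter k T (x i) - t ^+ k *: x i))) => k.
  exact: cvgZ0 (Ti k).
apply/cvgr0Pnorm_le => e e0; have e3 : 0 < e / 3 by rewrite divr_gt0.
have : \forall n \near \oo, (forall y, `|y| <= 1 -> `|op_poly (q n) T y - F y| <= e / 3)
    /\ `|f t - (q n).[t]| <= e / 3.
  near=> n; split; near: n; first exact: qF.
  have /cvgrPdist_le := qf _ t01; exact.
move=> [n _ /(_ n (leqnn n))[hF hf]].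
have /cvgr0Pnorm_le/(_ _ e3) := qT (q n); apply: filterS => i hq.
rewrite (_ : F (x i) - _ = - (op_poly (q n) T (x i) - F (x i)) +
  ((op_poly (q n) T (x i) - (q n).[t] *: x i) - (f t - (q n).[t]) *: x i)); last first.
  by rewrite scalerBl !opprB [X in _ = _ + X]addrA subrK addrA subrK.
rewrite (_ : e = e / 3 + (e / 3 + e / 3)); last by field.
rewrite (le_trans (ler_normD _ _))// lerD ?normrN ?hF//.
rewrite (le_trans (ler_normB _ _))// lerD// normrZ.
by rewrite (le_trans _ hf)// ler_piMr.
Unshelve. all: by end_near. Qed.

End functional_calculus_eigen.

(** * The spectral theorem *)

Lemma fmap_ultra T U (f : T -> U) (G : set_system T) :
  UltraFilter G -> UltraFilter (f @ G).
Proof.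
move=> GU; split=> [|K KP GK]; first exact: fmap_proper_filter.
rewrite eqEsubset; split=> // A KA.
have [//|nA] := @in_ultra_setVsetC _ _ (f @^-1` A) GU.
have : K (A `&` ~` A) by apply: filterI => //; apply: GK.
by rewrite setICr => /filter_not_empty.
Qed.

Section hilbert_schmidt_compact.
Context (R : realType) (H : hilbertType R) (S : {linear H -> H}).
Context (e : nat -> H).
Hypotheses (eO : ortho_seq e) (eT : total_seq e) (Sc : continuous S).
Hypothesis S_hs : (\sum_(0 <= i <oo) (`|S (e i)| ^+ 2)%:E < +oo)%E.

(** Young's inequality separates the tail of [S z] into the squared coefficients
    of [z], controlled by Bessel, and the tail of the Hilbert-Schmidt series,
    small uniformly in [z]. *)
Lemma hs_tail_le (r : R) : 0 < r -> exists N, forall z, `|z| <= 1 ->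
  `|S z - \sum_(0 <= i < N) '[z, e i] *: S (e i)| <= r.
Proof.
move=> r0.
have /fine_cvgP[tf] := nneseries_tail_cvg S_hs (fun k _ => ltac:(by rewrite lee_fin sqr_ge0)).
move=> /cvgr0Pnorm_le/(_ (r ^+ 2) (exprn_gt0 2 r0)) tn.
have [N _ /(_ N (leqnn N))[tfN tN]] := filterI tf tn.
have tail n : \sum_(N <= i < n) `|S (e i)| ^+ 2 <= r ^+ 2.
  rewrite -lee_fin -sumEFin; apply: (@le_trans _ _
    (\sum_(N <= i <oo) (`|S (e i)| ^+ 2)%:E)%E).
    by apply: nneseries_lim_ge => k _ _; rewrite lee_fin sqr_ge0.
  by rewrite -(fineK tfN) lee_fin (le_trans (ler_norm _) tN).
(* The weights r / 2 and 1 / (2 r) below balance a tail of size r ^+ 2. *)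
exists N => z z1.
set P := fun n => \sum_(0 <= i < n) '[z, e i] *: e i.
have SP n : S (P n) = \sum_(0 <= i < n) '[z, e i] *: S (e i).
  by rewrite linear_sum; apply: eq_bigr => i _; rewrite linearZ.
have c : (fun n => `|S (P n) - \sum_(0 <= i < N) '[z, e i] *: S (e i)|) @ \oo
    --> `|S z - \sum_(0 <= i < N) '[z, e i] *: S (e i)|.
  apply: cvg_norm; apply: cvgB; last exact: cvg_cst.
  by apply: continuous_cvg_comp => //; exact: (cvg_fourier eO eT).
rewrite -(cvg_lim _ c)//; apply: limr_le; first exact: cvgP c.
exists N => // n /= Nn; rewrite SP.
rewrite (big_cat_nat _ Nn)//= addrAC subrr add0r.
rewrite (le_trans (ler_norm_sum _ _ _))//.
apply: (@le_trans _ _ (\sum_(N <= i < n) (r / 2 * '[z, e i] ^+ 2 +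
    (2 * r)^-1 * `|S (e i)| ^+ 2))).
  apply: ler_sum => i _; rewrite normrZ -(@real_normK _ '[z, e i]) ?num_real//.
  set a := `|'[_, _]|; set b := `|S _|; rewrite -subr_ge0.
  have -> : r / 2 * a ^+ 2 + (2 * r)^-1 * b ^+ 2 - a * b =
     (2 * r)^-1 * (r * a - b) ^+ 2 by field; rewrite gt_eqF.
  by rewrite mulr_ge0 ?sqr_ge0// invr_ge0 mulr_ge0// ltW.
rewrite big_split/= -!mulr_sumr [leRHS]splitr lerD//.
  rewrite -[leRHS]mulr1 ler_wpM2l ?divr_ge0 ?(ltW r0)//.
  apply: (@le_trans _ _ (\sum_(0 <= i < n) '[z, e i] ^+ 2)).
    by rewrite [leRHS](big_cat_nat _ Nn)//= lerDr sumr_ge0// => i _; rewrite sqr_ge0.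
  by rewrite (le_trans (bessel eO z n))// exprn_ile1.
apply: (@le_trans _ _ ((2 * r)^-1 * r ^+ 2)).
  by rewrite ler_wpM2l ?invr_ge0 ?mulr_ge0 ?(ltW r0).
by rewrite le_eqVlt; apply/orP; left; apply/eqP; field; rewrite gt_eqF.
Qed.

(** Compactness of Hilbert-Schmidt operators. Along an ultrafilter every bounded
    coordinate of [x] converges, which replaces the diagonal extraction of a
    subsequence; finitely many coordinates determine [S (x i)] up to [r]. *)
Lemma hs_ultra_cvg I (G : set_system I) {GU : UltraFilter G} (x : I -> H) :
  (forall i, `|x i| <= 1) -> cvg ((fun i => S (x i)) @ G).
Proof.
move=> x1; apply: cauchy_cvg; apply: cauchy_exP => r r0.
have r2 : 0 < r / 2 by rewrite divr_gt0.
have [N hN] := hs_tail_le r2.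
have co k : exists l : R, (fun i => '[x i, e k]) @ G --> l.
  have := @segment_compact R (-1) 1; rewrite compact_ultra.
  move=> /(_ ((fun i => '[x i, e k]) @ G) _ _)[].
    exact: fmap_ultra.
    apply: (@filterE _ G) => i; rewrite /= in_itv/= -ler_norml.
    rewrite (le_trans (cauchy_schwarz _ _))// -[leRHS]mulr1 ler_pM//.
    by case: (ortho_seq_norm eO k) => ->; rewrite ?normr0.
  by move=> l [_ h]; exists l.
have [l lP] := boolp.choice co.
pose w := \sum_(0 <= i < N) l i *: S (e i).
exists w.
have cw : (fun i => \sum_(0 <= k < N) '[x i, e k] *: S (e k)) @ G --> w.
  by apply: cvg_bigsum => k; apply: cvgZl; exact: lP.
have /cvgrPdist_lt/(_ _ r2) := cw; apply: filterS => i h.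
rewrite -ball_normE/= [ltRHS]splitr.
apply: (le_lt_trans (ler_distD (\sum_(0 <= k < N) '[x i, e k] *: S (e k)) _ _)).
by rewrite ltr_leD// distrC hN.
Qed.

End hilbert_schmidt_compact.

Section spectral_theorem.
Context (R : realType) (H : hilbertType R) (H_sep : separable H) (T : H -> H).
Hypothesis TD : forall x y, T (x + y) = T x + T y.
Hypothesis TZ : forall c x, T (c *: x) = c *: T x.
Hypothesis T_le1 : forall x, `|T x| <= `|x|.
Hypothesis TS : self_adjoint T.
Hypothesis T_ge0 : forall x, 0 <= '[x, T x].
Context (f : R -> R) (F : H -> H) (S : {linear H -> H}).
Hypothesis f_gt0 : forall l, 0 < l -> 0 < f l.
Hypothesis Ff : is_fun_calc T f F.
Hypothesis SF : is_sqrt F S.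
Hypothesis F_tr : (trace F < +oo)%E.

Let TB a b : T (a - b) = T a - T b.
Proof. by rewrite TD -scaleN1r TZ scaleN1r. Qed.

Let Tc : continuous T.
Proof. by apply: (@lipschitz_continuous _ _ _ _ 1) => a b; rewrite -TB mul1r. Qed.

Let Sc : continuous S.
Proof. exact: Defs.sqrt_continuous SF. Qed.

Let opnormT_le1 : (opnorm T <= 1%:E)%E.
Proof. by apply: opnorm_le => x x1; rewrite (le_trans (T_le1 _)). Qed.

Let opnormT_fin : opnorm T \is a fin_num.
Proof.
rewrite ge0_fin_numE ?opnorm_ge0//; exact: le_lt_trans opnormT_le1 (ltry _).
Qed.

Let norm_T_le x : `|x| <= 1 -> `|T x| <= fine (opnorm T).
Proof. by move=> x1; rewrite -lee_fin fineK// opnorm_ge. Qed.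

Lemma eigenvalue_bound (l : R) (v : H) : v != 0 -> T v = l *: v ->
  0 <= l <= fine (opnorm T).
Proof.
move=> v0 Tv; have nv : 0 < `|v| by rewrite normr_gt0.
apply/andP; split.
  have := T_ge0 v; rewrite Tv dotZr dotp_norm pmulr_lge0//.
  by rewrite exprn_gt0.
have := norm_T_le (unit_scale_le1 v0).
rewrite TZ Tv !normrZ normfV normr_id mulrCA mulVf ?gt_eqF// mulr1.
exact/le_trans/ler_norm.
Qed.

Lemma sqrt_hs (e : nat -> H) :
  (forall g : H -> \bar R, (forall x, (0 <= g x)%E) -> g 0 = 0%E ->
      (\esum_(e in onb) g e = \sum_(0 <= i <oo) g (e i))%E) ->
  (\sum_(0 <= i <oo) (`|S (e i)| ^+ 2)%:E < +oo)%E.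
Proof.
move=> ee; rewrite -(ee (fun x => (`|S x| ^+ 2)%:E)).
- rewrite (_ : \esum_(_ in _) _ = trace F)//; apply: eq_esum => x _.
  by rewrite -dotp_norm (sqrt_self_adjoint SF) (sqrtK SF).
- by move=> x; rewrite lee_fin sqr_ge0.
- by rewrite linear0 normr0 expr0n.
Qed.

Section invariant_subspace.
Variable E : set H.
Hypothesis ET : forall e, E e -> exists l, T e = l *: e.
Let M := [set x | forall e, E e -> '[x, e] = 0].

Let MZ c x : M x -> M (c *: x).
Proof. by move=> Mx e Ee; rewrite dotZl Mx// mulr0. Qed.

Let MT x : M x -> M (T x).
Proof. by move=> Mx e Ee; have [l Te] := ET Ee; rewrite TS Te dotZr Mx// mulr0. Qed.

(** Let [t] be the supremum of [<x, T x>] over the unit ball of [M]. If [t = 0]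
    then [T] vanishes on [M]. Otherwise a maximizing sequence satisfies
    [T x_n - t x_n -> 0], hence [F x_n - f t x_n -> 0]; as [F = S S] is compact
    and [0 < f t], the sequence converges along an ultrafilter. *)
Lemma exists_eigenvector x0 : M x0 -> x0 != 0 ->
  exists y l, [/\ M y, `|y| = 1 & T y = l *: y].
Proof.
move=> Mx0 x00.
pose A := [set '[x, T x] | x in [set x | M x /\ `|x| <= 1]].
have dT1 x : `|x| <= 1 -> '[x, T x] <= fine (opnorm T).
  move=> x1; rewrite (le_trans (ler_norm _))// (le_trans (cauchy_schwarz _ _))//.
  by rewrite (le_trans _ (norm_T_le x1))// ler_piMl.
have hA : has_sup A.
  split; first by exists '[0, T 0], 0 => //; split; rewrite ?normr0// => e _; rewrite dot0l.
  by exists (fine (opnorm T)) => _ [x [_ x1] <-]; exact: dT1.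
pose t := sup A.
have At x : M x -> `|x| <= 1 -> '[x, T x] <= t.
  by move=> Mx x1; apply: sup_upper_bound => //; exists x.
have AM x : M x -> '[x, T x] <= t * `|x| ^+ 2.
  move=> Mx; have [->|xn0] := eqVneq x 0; first by rewrite dot0l normr0 expr0n mulr0.
  have n0 : 0 < `|x| ^+ 2 by rewrite exprn_gt0// normr_gt0.
  rewrite -ler_pdivrMr//.
  have := At _ (MZ (`|x|^-1) Mx) (unit_scale_le1 xn0).
  by rewrite TZ dotZl dotZr mulrA -expr2 exprVn mulrC.
have t0 : 0 <= t.
  have M0 : M 0 by move=> e _; rewrite dot0l.
  by have := At 0 M0; rewrite normr0 dot0l; apply.
have t1 : t <= fine (opnorm T).
  by apply: ge_sup; [exact: hA.1|move=> _ [x [_ x1] <-]; exact: dT1].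
(* Positivity of T at x - s T x; to be used at s = 1 if t = 0 and at s = t^-1
   otherwise. *)
have Tx2 x s : M x -> 0 <= '[x, T x] - 2 * s * `|T x| ^+ 2 + s ^+ 2 * t * `|T x| ^+ 2.
  move=> Mx; apply: (le_trans (T_ge0 (x - s *: T x))).
  rewrite TB TZ !dotBl !dotBr !dotZl !dotZr -(TS x (T x)) dotp_norm.
  have := AM _ (MT Mx); set b := '[T x, _] => hb.
  have : s ^+ 2 * b <= s ^+ 2 * (t * `|T x| ^+ 2) by rewrite ler_wpM2l ?sqr_ge0.
  lra.
move: t0; rewrite le_eqVlt => /predU1P[te|t0].
  exists (`|x0|^-1 *: x0), 0; split; [exact: MZ|exact: unit_scale|].
  rewrite TZ (_ : T x0 = 0) ?scaler0 ?scale0r//.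
  have := Tx2 x0 1 Mx0; have := AM _ Mx0; rewrite -te !mul0r mulr0 mul0r addr0 => h1 h2.
  apply/eqP; rewrite -normr_eq0 -sqrf_eq0 eq_le sqr_ge0 andbT.
  by have := T_ge0 x0; lra.
have hx n : exists x, [/\ M x, `|x| <= 1 & t - n.+1%:R^-1 <= '[x, T x]].
  have n0 : 0 < n.+1%:R^-1 :> R by rewrite invr_gt0.
  have [_ [x [Mx x1] <-] h] := sup_adherent n0 hA.
  by exists x; split=> //; exact: ltW.
have [x xP] := boolp.choice hx.
have x1 n : `|x n| <= 1 by case: (xP n).
have Mxn n : M (x n) by case: (xP n).
have [G [GU Goo]] := ultraFilterLemma eventually_filter.
have Ginv (V : normedModType R) (g : nat -> V) :
  (forall n, `|g n| ^+ 2 <= t * n.+1%:R^-1) -> g @ G --> 0.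
  move=> hg; apply/cvgr0Pnorm_le => r r0; apply: Goo.
  have : (fun n => t * harmonic n) @ \oo --> t * 0 by apply: cvgMr; exact: cvg_harmonic.
  rewrite mulr0 => /cvgr0Pnorm_le/(_ (r ^+ 2) (exprn_gt0 2 r0)).
  apply: filterS => n hn.
  rewrite -(@ler_pXn2r _ 2) ?nnegrE ?(ltW r0)//.
  by rewrite (le_trans (hg n))// (le_trans _ hn)// ler_norm.
have Tx : (fun n => T (x n) - t *: x n) @ G --> 0.
  apply: Ginv => n; rewrite normB_sqr normrZ exprMn dotZr (dotC (T _)).
  have := Tx2 (x n) t^-1 (Mxn n); have [_ _ h] := xP n.
  rewrite real_normK ?num_real//.
  set a := '[_, _] in h *; set b := `|T _| ^+ 2 => hb.
  have {}hb : b <= t * a.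
    have -> : t * a = b + t * (a - 2 / t * b + t^-1 ^+ 2 * t * b).
      by field; rewrite gt_eqF.
    by rewrite lerDl mulr_ge0// ltW.
  have x2 : t ^+ 2 * `|x n| ^+ 2 <= t ^+ 2 by rewrite ler_piMr ?sqr_ge0// exprn_ile1.
  have := ler_wpM2l (ltW t0) h; rewrite mulrBr -expr2 mulr2n.
  have key (b' ta tx tt c : R) : b' <= ta -> tx <= tt -> tt - c <= ta ->
    b' - (ta + ta) + tx <= c by lra.
  exact: key hb x2.
have t01 : 0 <= t <= fine (opnorm T) by rewrite (ltW t0).
have Fx : (fun n => F (x n) - f t *: x n) @ G --> 0.
  exact: (fun_calc_approx_eigen TD TZ T_le1 Ff).
have [e [eO eT ee]] := onb_enum H_sep.
have [w Sx] : exists w : H, (fun n => S (x n)) @ G --> w.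
  by eexists; exact: (hs_ultra_cvg eO eT Sc (sqrt_hs ee) x1).
have FS : (fun n => F (x n)) @ G --> S w.
  rewrite (_ : (fun n => F (x n)) = (fun n => S (S (x n)))).
    exact: continuous_cvg_comp.
  by apply/funext => n; rewrite (sqrtK SF).
pose y := (f t)^-1 *: S w.
have xy : x @ G --> y.
  have ft := f_gt0 t0.
  rewrite (_ : x = (fun n => (f t)^-1 *: (F (x n) - (F (x n) - f t *: x n)))).
    by apply: cvgZr; rewrite -[S w]subr0; apply: cvgB.
  by apply/funext => n; rewrite opprB addrC subrK scalerA mulVf ?gt_eqF// scale1r.
have Txy : (fun n => T (x n)) @ G --> T y by exact: continuous_cvg_comp.
have Ty : T y = t *: y.
  apply/eqP; rewrite -subr_eq0; apply/eqP.
  have Tx' : (fun n => T (x n) - t *: x n) @ G --> T y - t *: y.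
    by apply: cvgB; [exact: Txy|exact: cvg_scale].
  exact: (cvg_unique _ Tx' Tx).
have yn0 : y != 0.
  apply/eqP => y0.
  have h : (fun n => '[x n, T (x n)]) @ G --> 0.
    by rewrite -(dot0l (T y)) -[X in '[X, _]]y0; exact: cvg_dot.
  have h' : (fun n => t - '[x n, T (x n)] : R^o) @ G --> (0 : R^o).
    apply: Ginv => n; have [Mx _ hn] := xP n; have := T_ge0 (x n).
    have := At _ Mx (x1 n); set a := '[_, _] in hn * => a1 a0.
    rewrite ger0_norm ?subr_ge0// expr2 ler_pM ?subr_ge0//.
      by rewrite lerBlDr lerDl.
    by move: hn; rewrite !lerBlDr addrC.
  have h2 : (fun n => t - '[x n, T (x n)]) @ G --> t - 0.
    by apply: cvgB; [exact: cvg_cst|exact: h].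
  have : t = 0 by rewrite -[t]subr0; apply: (cvg_unique _ h2 h').
  by move/eqP; rewrite gt_eqF.
exists (`|y|^-1 *: y), t; split; [apply: MZ|exact: unit_scale|by rewrite TZ Ty scalerA mulrC -scalerA].
move=> a Ea; have h : (fun n => '[x n, a]) @ G --> '[y, a] by exact: cvg_dotl.
apply: (cvg_unique _ h) => //; rewrite (_ : (fun n => _) = cst 0); first exact: cvg_cst.
by apply/funext => n; rewrite /= Mxn.
Qed.

End invariant_subspace.

(** A maximal orthonormal set of eigenvectors is total, since the orthogonal
    complement would contain a further eigenvector. *)
Lemma spectral_theorem : exists (v : nat -> H) (l : nat -> R),
  [/\ ortho_seq v, total_seq v, forall i, T (v i) = l i *: v i &
      forall i, 0 <= l i <= fine (opnorm T)].
Proof.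
have [E [EQ EO Emax]] := maximal_orthonormal [set x | exists l, T x = l *: x].
have [v [vO vE Ev _]] := orthonormal_enum (orthonormal_countable H_sep EO) EO.
have T0 : T 0 = 0 by rewrite -(scale0r 0) TZ !scale0r.
have Tv i : T (v i) = '[v i, T (v i)] *: v i.
  case: (vE i) => [->|Ei]; first by rewrite T0 scaler0.
  have [l ->] := EQ _ Ei; rewrite dotZr.
  by case: (ortho_seq_sq vO i) => ->; rewrite ?mulr1// !scaler0.
(* This formula for the eigenvalue gives 0 on the zero entries of v. *)
exists v, (fun i => '[v i, T (v i)]); split=> // [x xv|i].
  apply/eqP/negPn/negP => x0.
  have Mx e : E e -> '[x, e] = 0 by move=> /Ev[i <-].
  have [y [l [My y1 Ty]]] := exists_eigenvector EQ Mx x0.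
  by apply: (Emax y) => //; exists l.
have [vi0|vi0] := eqVneq (v i) 0.
  by rewrite vi0 dot0l lexx fine_ge0// opnorm_ge0.
exact: eigenvalue_bound (Tv i).
Qed.

End spectral_theorem.

(** * Operators diagonal in a basis *)

Lemma op_invE (R : realType) (U V : hilbertType R) (D : set U) (T : U -> V) x y :
  {in D &, injective T} -> D x -> T x = y -> op_inv D T y = x.
Proof.
by move=> TI Dx <-; apply: (pinvKV _ TI); rewrite inE.
Qed.

Section diagonal_operators.
Context (R : realType) (H : hilbertType R) (v : nat -> H).
Hypotheses (vO : ortho_seq v) (vT : total_seq v).
Implicit Types (F G T : H -> H) (a b l : nat -> R) (M : R).

Definition diagonal a F := forall x i, '[F x, v i] = a i * '[x, v i].

Lemma diagonal_comp a b F G : diagonal a F -> diagonal b G ->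
  diagonal (fun i => a i * b i) (F \o G).
Proof. by move=> Fa Gb x i; rewrite /= Fa Gb mulrA. Qed.

Lemma diagonal_iter a F k : diagonal a F -> diagonal (fun i => a i ^+ k) (iter k F).
Proof.
move=> Fa x i; elim: k => [|k IH]; first by rewrite expr0 mul1r.
by rewrite iterS Fa IH mulrA exprS.
Qed.

Lemma diagonal_norm_le a F M : 0 <= M -> diagonal a F -> (forall i, `|a i| <= M) ->
  forall x, `|F x| <= M * `|x|.
Proof.
move=> M0 Fa aM x; rewrite -(@ler_pXn2r _ 2) ?nnegrE ?mulr_ge0// exprMn.
apply: (norm_sqr_le_coef vO vT) => i; rewrite Fa exprMn ler_wpM2r ?sqr_ge0//.
by rewrite -(@real_normK _ (a i)) ?num_real// lerXn2r ?nnegrE.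
Qed.

(** The exponential series converges in norm because the iterates of [F] grow at
    most like [M ^+ k]; its coefficients are then exponential series of reals. *)
Lemma diagonal_op_exp a F M : diagonal a F -> (forall i, `|a i| <= M) ->
  diagonal (fun i => expR (a i)) (op_exp F).
Proof.
move=> Fa aM x i; have M0 : 0 <= M by rewrite (le_trans _ (aM 0)).
have Fk k : `|iter k F x| <= M ^+ k * `|x|.
  elim: k => [|k IH]; first by rewrite expr0 mul1r.
  rewrite iterS (le_trans (diagonal_norm_le M0 Fa aM _))// exprS -mulrA.
  by rewrite ler_wpM2l.
have sc : cvgn (series (fun k => (k`!%:R)^-1 *: iter k F x)).
  apply: normed_cvg; apply: (@series_le_cvg _ _ (fun k => exp_coeff M k * `|x|)).
  - by move=> n; exact: normr_ge0.
  - by move=> n; rewrite mulr_ge0// exp_coeff_ge0.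
  - move=> n /=; rewrite normrZ exp_coeffE/= -mulrA.
    by rewrite ger0_norm ?invr_ge0// ler_wpM2l// invr_ge0.
  rewrite (_ : series _ = (fun n => series (exp_coeff M) n * `|x|)); last first.
    by apply/funext => n; rewrite /series/= mulr_suml.
  by apply: is_cvgMl; exact: is_cvg_series_exp_coeff.
have c1 : (fun n => '[series (fun k => (k`!%:R)^-1 *: iter k F x) n, v i]) @ \oo
    --> '[op_exp F x, v i] by exact: cvg_dotl.
have c2 : (fun n => series (exp_coeff (a i)) n * '[x, v i]) @ \oo
    --> expR (a i) * '[x, v i].
  by apply: cvgMl; exact: is_cvg_series_exp_coeff.
apply: (cvg_eq_lim (V := R^o) c1 c2) => n; rewrite /series/= dot_suml mulr_suml; apply: eq_bigr => k _.
by rewrite dotZl (diagonal_iter k Fa) exp_coeffE/= mulrA.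
Qed.

(** Dominated convergence for the partial Fourier sums of [<F s x, y>], whose
    integrals are the partial sums of the expansion of the claimed integral. *)
Lemma diagonal_op_integral (s0 s1 : R) (c : R -> nat -> R) (L : nat -> R)
    (F : R -> H -> H) (M M' : R) :
  (forall s, s0 <= s <= s1 -> diagonal (c s) (F s)) ->
  (forall i, {within `[s0, s1], continuous (c ^~ i)}) ->
  (forall s i, s0 <= s <= s1 -> `|c s i| <= M) ->
  (forall i, \int[lebesgue_measure]_(s in `[s0, s1]) (c s i)%:E = (L i)%:E)%E ->
  (forall i, `|L i| <= M') ->
  diagonal L (op_integral s0 s1 F).
Proof.
move=> Fc cc cM cL LM.
have key x : [set w | forall y,
    lebesgue_measure.-integrable `[s0, s1] (fun s => (dotp (F s x) y)%:E) /\
    dotp w y = \int[lebesgue_measure]_(s in `[s0, s1]) dotp (F s x) y]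
  (op_integral s0 s1 F x).
  apply: xgetPex; exists (fourier_diag v L x) => y.
  pose f n (s : R) : \bar R := (\sum_(0 <= i < n) (c s i * '[x, v i]) * '[y, v i])%:E.
  have ci i : lebesgue_measure.-integrable `[s0, s1] (fun s => (c s i)%:E).
    by apply: continuous_compact_integrable => //; exact: segment_compact.
  have cxy i : lebesgue_measure.-integrable `[s0, s1]
      (fun s => (c s i * '[x, v i] * '[y, v i])%:E).
    rewrite (_ : (fun s => _) =
       (fun s => ('[x, v i] * '[y, v i])%:E * (c s i)%:E)%E).
      by apply: integrableZl.
    by apply/funext => s; rewrite -EFinM; congr (_%:E); ring.
  have fE n s : f n s = (\sum_(0 <= i < n) (c s i * '[x, v i] * '[y, v i])%:E)%E.
    by rewrite sumEFin.
  have mf n : measurable_fun `[s0, s1] (f n).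
    rewrite (funext (fE n)); apply: (measurable_int lebesgue_measure).
    by apply: integrable_sum.
  have fcvg s : `[s0, s1]%classic s -> f ^~ s @ \oo --> ('[F s x, y])%:E.
    rewrite /= in_itv/= => s01; apply: cvg_EFin; first exact: nearW.
    have := @cvg_parseval_dot _ _ _ vO vT (F s x) y.
    rewrite (_ : series _ = fine \o f ^~ s)//; apply/funext => n.
    by rewrite /series/=; apply: eq_bigr => i _; rewrite (Fc _ s01).
  have mF : measurable_fun `[s0, s1] (fun s : R => ('[F s x, y])%:E).
    exact: (emeasurable_fun_cvg _ _ mf fcvg).
  pose B := M * ((`|x| ^+ 2 + `|y| ^+ 2) / 2).
  have fB s n : `[s0, s1]%classic s -> (`|f n s| <= (cst B s)%:E)%E.
    rewrite /= in_itv/= => s01; rewrite /f lee_fin (le_trans (ler_norm_sum _ _ _))//.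
    have M0 : 0 <= M by rewrite (le_trans _ (cM s 0 s01)).
    apply: (@le_trans _ _ (\sum_(0 <= i < n) M * (('[x, v i] ^+ 2 + '[y, v i] ^+ 2) / 2))).
      apply: ler_sum => i _; rewrite -mulrA normrM ler_pM ?cM// normrM.
      rewrite -!(real_normK (num_real '[_, v i])) -subr_ge0.
      set p := `|_|; set q := `|_|.
      rewrite (_ : _ - _ = (p - q) ^+ 2 / 2); last by field.
      by rewrite divr_ge0// sqr_ge0.
    rewrite -mulr_sumr ler_wpM2l// -mulr_suml ler_wpM2r// big_split/=.
    by rewrite lerD ?bessel.
  have Bi : lebesgue_measure.-integrable `[s0, s1] (EFin \o cst B).
    apply: continuous_compact_integrable; first exact: segment_compact.
    by apply: continuous_subspaceT => z; exact: cvg_cst.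
  have [||Fi _ cF] := @dominated_convergence _ (measurableTypeR R) R
    lebesgue_measure _ (measurable_itv _) f (fun s => ('[F s x, y])%:E)
    (EFin \o cst B) mf mF _ Bi _.
  - by apply: aeW => s; exact: fcvg.
  - by apply: aeW => s n; exact: fB.
  split=> //.
  have cD := @cvg_parseval_dot _ _ _ vO vT (fourier_diag v L x) y.
  have intf n : (\int[lebesgue_measure]_(s in `[s0, s1]) f n s =
      (series (fun k => '[fourier_diag v L x, v k] * '[y, v k]) n)%:E)%E.
    rewrite (eq_integral (fun s : measurableTypeR R => \sum_(0 <= i < n)
      (c s i * '[x, v i] * '[y, v i])%:E)%E); last by move=> s _; exact: fE.
    rewrite integral_sum// /series/= -sumEFin; apply: eq_bigr => i _.
    rewrite (dot_fourier_diag vO LM) -mulrA mulrC EFinM -cL.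
    rewrite -integralZl//; apply: eq_integral => s _.
    by rewrite -EFinM -mulrA mulrC.
  rewrite /Rintegral -(cvg_lim _ cF)//=; under eq_fun do rewrite intf.
  suff -> : limn (fun n => (series (fun k =>
      '[fourier_diag v L x, v k] * '[y, v k]) n)%:E) =
    ('[fourier_diag v L x, y])%:E by [].
  apply: cvg_lim => //; apply: cvg_EFin; last exact: cD.
  exact: nearW.
move=> x j; have [_ ->] := key x (v j).
under eq_Rintegral.
  move=> s; rewrite inE/= in_itv/= => s01; rewrite (Fc _ s01); over.
rewrite /Rintegral; under eq_integral do rewrite EFinM muleC.
rewrite integralZl//; first by rewrite cL -EFinM mulrC.
apply: continuous_compact_integrable => //; exact: segment_compact.
Qed.

End diagonal_operators.

(** * The logarithmic integral *)

Section log_integral.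
Context (R : realType) (alpha sig : R).
Hypotheses (alpha0 : 0 < alpha) (sig0 : 0 <= sig).

Let den_gt0 s : 0 <= s -> 0 < alpha + s * sig.
Proof. by move=> s0; rewrite ltr_wpDr// mulr_ge0. Qed.

Let is_derive_den (s : R) : is_derive s 1 (fun s => alpha + s * sig) sig.
Proof.
apply: is_derive_eq.
by rewrite add0r mul1r scaler0 add0r /GRing.scale/= mulr1.
Qed.

Let continuous_den : continuous (fun s : R => alpha + s * sig).
Proof.
move=> s; apply: differentiable_continuous; apply/derivable1_diffP.
by have [] := is_derive_den s.
Qed.

Let is_derive_log (s : R) : 0 < alpha + s * sig ->
  is_derive s 1 (fun s => ln (alpha + s * sig)) (sig / (alpha + s * sig)).
Proof.
move=> d0; rewrite mulrC.
exact: (@is_derive1_comp _ (@ln R) (fun s => alpha + s * sig) s _ _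
   (is_derive1_ln d0) (is_derive_den s)).
Qed.

Lemma continuous_log_density (a b : R) : 0 <= a ->
  {within `[a, b], continuous (fun s => sig / (alpha + s * sig))}.
Proof.
move=> a0; apply: continuous_in_subspaceT => s; rewrite inE/= in_itv/= => /andP[as_ _].
apply: cvgM; first exact: cvg_cst.
apply: cvgV; last exact: continuous_den.
by rewrite gt_eqF// den_gt0// (le_trans a0).
Qed.

Lemma integral_log_density (a b : R) : 0 <= a -> a <= b ->
  (\int[lebesgue_measure]_(s in `[a, b]) (sig / (alpha + s * sig))%:E =
   (ln (alpha + b * sig) - ln (alpha + a * sig))%:E)%E.
Proof.
move=> a0; rewrite le_eqVlt => /predU1P[<-|ab].
  by rewrite subrr set_itv1 integral_set1.
have clog (s : R) : 0 <= s -> {for s, continuous (fun z : R => ln (alpha + z * sig))}.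
  move=> s0; apply: differentiable_continuous; apply/derivable1_diffP.
  by have [] := is_derive_log (den_gt0 s0).
rewrite (continuous_FTC2 (F := fun s => ln (alpha + s * sig)) ab)//.
- exact: continuous_log_density.
- split.
  + move=> s; rewrite in_itv/= => /andP[as_ _].
    by have [] := is_derive_log (den_gt0 (ltW (le_lt_trans a0 as_))).
  + exact: cvg_at_right_filter (clog _ a0).
  + by apply: cvg_at_left_filter; apply: clog; lra.
- move=> s; rewrite in_itv/= => /andP[as_ _].
  by rewrite derive1E; have [] := is_derive_log (den_gt0 (ltW (le_lt_trans a0 as_))).
Qed.

End log_integral.

(** * Traces and the operators of the method *)

Section trace_diagonal.
Context (R : realType) (H : hilbertType R) (H_sep : separable H) (v : nat -> H).
Hypotheses (vO : ortho_seq v) (vT : total_seq v).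

(** Expand in [v] inside the sum over [onb], exchange the two nonnegative series
    and sum over [onb] first. *)
Lemma trace_diagonal (a : nat -> R) (F : H -> H) :
  (forall i, 0 <= a i) -> diagonal v a F ->
  trace F = (\sum_(0 <= i <oo) (a i * '[v i, v i])%:E)%E.
Proof.
move=> a0 Fa; have [e [eO eT ee]] := onb_enum H_sep.
have dE x : ('[x, F x])%:E = (\sum_(0 <= i <oo) (a i * '[x, v i] ^+ 2)%:E)%E.
  apply/esym/cvg_lim => //; under eq_cvg do rewrite sumEFin.
  apply: cvg_EFin; first exact: nearW.
  have := @cvg_parseval_dot _ _ _ vO vT (F x) x; rewrite dotC.
  rewrite (_ : series _ = fine \o (fun n => (\sum_(0 <= i < n) a i * '[x, v i] ^+ 2)%:E))//.
  by apply/funext => n; apply: eq_bigr => i _; rewrite Fa expr2 mulrA.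
have p0 x i : 0 <= a i * '[x, v i] ^+ 2 by rewrite mulr_ge0// sqr_ge0.
rewrite /trace ee => [|x|]; last by rewrite dot0l.
  under eq_eseriesr do rewrite dE.
  rewrite nneseries_interchange; last by move=> i j; rewrite lee_fin.
  apply: eq_eseriesr => i _; under eq_eseriesr do rewrite EFinM dotC.
  rewrite nneseriesZl; last by move=> k _; rewrite lee_fin sqr_ge0.
  by rewrite -(parseval eO eT) -EFinM dotp_norm.
by rewrite dE; apply: nneseries_ge0 => i _; rewrite lee_fin.
Qed.

(** The same exchange of series; [k i] plays the role of the image of [v i] under
    the adjoint of [F]. *)
Lemma hs_norm2_coef (Y : hilbertType R) (Y_sep : separable Y) (F : Y -> H)
    (k : nat -> Y) : (forall y i, '[F y, v i] = '[y, k i]) ->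
  hs_norm2 F = (\sum_(0 <= i <oo) (`|k i| ^+ 2)%:E)%E.
Proof.
move=> Fk; have [e [eO eT ee]] := onb_enum Y_sep.
rewrite /hs_norm2 ee => [|x|]; last first.
- rewrite (_ : F 0 = 0) ?normr0 ?expr0n//.
  by apply: vT => i; rewrite Fk dot0l.
- by rewrite lee_fin sqr_ge0.
under eq_eseriesr do rewrite (parseval vO vT).
rewrite nneseries_interchange; last by move=> i j; rewrite lee_fin sqr_ge0.
apply: eq_eseriesr => i _; under eq_eseriesr do rewrite Fk dotC.
by rewrite -(parseval eO eT).
Qed.

Lemma effective_dimension_diagonal (sig : nat -> R) (S : H -> H) (eps : R) :
  0 < eps -> (forall i, 0 <= sig i) -> diagonal v sig S ->
  effective_dimension S eps =
    (\sum_(0 <= i <oo) (sig i / (eps + sig i) * '[v i, v i])%:E)%E.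
Proof.
move=> e0 s0 Ss; have d0 i : 0 < eps + sig i by rewrite ltr_pwDl.
have t0 i : 0 <= sig i / (eps + sig i) by rewrite divr_ge0// ltW.
apply: trace_diagonal => // x i.
have t1 j : `|sig j / (eps + sig j)| <= 1.
  by rewrite ger0_norm// ler_pdivrMr// mul1r lerDr ltW.
rewrite (@op_invE _ _ _ _ _ (fourier_diag v (fun i => sig i / (eps + sig i)) x))//.
- exact: (dot_fourier_diag vO t1).
- move=> a b _ _ ab; apply: (coef_inj vT) => j.
  have /(congr1 (fun z => '[z, v j])) := ab.
  rewrite !dotDl !dotZl !Ss -!mulrDl => /mulfI; apply.
  by rewrite gt_eqF.
- apply: (coef_inj vT) => j.
  rewrite dotDl dotZl !Ss (dot_fourier_diag vO t1) -mulrDl mulrA.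
  by rewrite [X in X * _]mulrC divfK// gt_eqF.
Qed.

End trace_diagonal.

Section arm_diagonal.
Context (R : realType) (H : hilbertType R) (v : nat -> H).
Hypotheses (vO : ortho_seq v) (vT : total_seq v).
Context (T Om : H -> H) (l mu : nat -> R) (alpha : R).
Hypotheses (Tl : diagonal v l T) (Om_mu : diagonal v mu Om) (Om_inj : injective Om).
Hypotheses (l0 : forall i, 0 <= l i) (mu0 : forall i, 0 <= mu i).
Hypothesis alpha0 : 0 < alpha.
Let sig i := l i * mu i.
Hypothesis sig1 : forall i, sig i <= 1.
Let C0 x := alpha^-1 *: Om x.

Let sig0 i : 0 <= sig i. Proof. exact: mulr_ge0. Qed.

Let den_ge s i : 0 <= s -> alpha <= alpha + s * sig i.
Proof. by move=> s0; rewrite lerDl mulr_ge0. Qed.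

Let den_gt0 s i : 0 <= s -> 0 < alpha + s * sig i.
Proof. by move=> s0; rewrite (lt_le_trans alpha0)// den_ge. Qed.

(** The element [u = C0 w] of the range of [C0] solves [C0^-1 u + s T u = x] when
    [w] has the coefficients of [x] times [alpha / (alpha + s * sig i)]. *)
Lemma diagonal_arm_cov s : 0 <= s ->
  diagonal v (fun i => mu i / (alpha + s * sig i)) (arm_cov C0 T s).
Proof.
move=> s0 x i; have an0 : alpha != 0 by rewrite gt_eqF.
have C0inj : injective C0.
  by move=> a b /(scalerI (invr_neq0 an0)); exact: Om_inj.
have C0K w : op_inv setT C0 (C0 w) = w by apply: op_invE => // ? ? _ _; exact: C0inj.
have r1 j : `|alpha / (alpha + s * sig j)| <= 1.
  rewrite ger0_norm; last by rewrite divr_ge0 ?ltW// den_gt0.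
  by rewrite ler_pdivrMr ?den_gt0// mul1r den_ge.
pose w := fourier_diag v (fun j => alpha / (alpha + s * sig j)) x.
rewrite /arm_cov (@op_invE _ _ _ _ _ (C0 w)).
- rewrite /C0 dotZl Om_mu (dot_fourier_diag vO r1).
  by field; rewrite an0 gt_eqF// den_gt0.
- move=> _ _ /set_mem[a _ <-] /set_mem[b _ <-]; rewrite !C0K => ab.
  congr C0; apply: (coef_inj vT) => j.
  have /(congr1 (fun z => '[z, v j])) := ab.
  rewrite !dotDl !dotZl !Tl /C0 !dotZl !Om_mu => h.
  have /mulfI/(_ _ _) : 1 + s * (l j * (alpha^-1 * mu j)) != 0.
    by rewrite gt_eqF// ltr_pwDl// !mulr_ge0// invr_ge0 ltW.
  apply; lra.
- by exists w.
rewrite C0K; apply: (coef_inj vT) => j.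
rewrite dotDl dotZl Tl /C0 dotZl Om_mu (dot_fourier_diag vO r1) /sig.
by field; rewrite an0 gt_eqF// den_gt0.
Qed.

(** The generator [C(s) T] has the eigenvalues [sig i / (alpha + s * sig i)],
    which are logarithmic derivatives in [s]. *)
Lemma diagonal_arm_flow a b : 0 <= a -> a <= b ->
  diagonal v (fun i => (alpha + a * sig i) / (alpha + b * sig i)) (arm_flow C0 T a b).
Proof.
move=> a0 ab; have b0 : 0 <= b := le_trans a0 ab.
pose L i := ln (alpha + b * sig i) - ln (alpha + a * sig i).
have Lb i : `|L i| <= ln (alpha + b) - ln alpha.
  rewrite ger0_norm.
    rewrite lerB// ler_ln ?posrE ?den_gt0// ?den_ge// ?ltr_wpDr//.
    by rewrite lerD2l ler_piMr.
  by rewrite subr_ge0 ler_ln ?posrE ?den_gt0// lerD2l ler_wpM2r.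
have DL : diagonal v L (op_integral a b (fun s => arm_cov C0 T s \o T)).
  apply: (@diagonal_op_integral _ _ _ vO vT _ _
    (fun s i => sig i / (alpha + s * sig i)) _ _ alpha^-1 _ _ _ _ _ Lb).
  - move=> s /andP[as_ _] x i.
    rewrite (diagonal_comp (diagonal_arm_cov (le_trans a0 as_)) Tl).
    by congr (_ * _); rewrite /sig mulrAC (mulrC (mu i)).
  - by move=> i; exact: continuous_log_density.
  - move=> s i /andP[as_ _]; have s0 := le_trans a0 as_.
    rewrite ger0_norm; last by rewrite divr_ge0// ltW// den_gt0.
    rewrite -[leRHS]mul1r ler_pM ?invr_ge0 ?sig0 ?sig1 ?(ltW (den_gt0 _ s0))//.
    by rewrite lef_pV2 ?posrE ?den_gt0// den_ge.
  - by move=> i; exact: integral_log_density.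
have DN : diagonal v (fun i => - L i)
    (fun x => - op_integral a b (fun s => arm_cov C0 T s \o T) x).
  by move=> x i; rewrite dotNl DL mulNr.
move=> x i; rewrite /arm_flow (diagonal_op_exp vO vT DN (M := ln (alpha + b) - ln alpha)).
  by rewrite /L opprB expRD expRN !lnK ?posrE ?den_gt0.
by move=> j; rewrite normrN.
Qed.

End arm_diagonal.

(** * Step integrands *)

Section finite_sums.
Context (R : realType).

Lemma eseries_EFin (u : nat -> R) (r : R) : series u @ \oo --> r ->
  (\sum_(0 <= i <oo) (u i)%:E = r%:E)%E.
Proof.
move=> ur; apply: cvg_lim => //; under eq_cvg do rewrite sumEFin.
by apply: cvg_EFin; [exact: nearW|exact: ur].
Qed.

Lemma norm_sqr_sum (H : hilbertType R) n (b : H) (c : 'I_n -> R) (x : 'I_n -> H) :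
  `|b - \sum_(i < n) c i *: x i| ^+ 2 = `|b| ^+ 2 - 2 * (\sum_(i < n) '[b, x i] * c i) +
    \sum_(i < n) \sum_(j < n) '[x i, x j] * (c i * c j).
Proof.
rewrite normB_sqr dot_sumr -[`|\sum_(_ < _) _| ^+ 2]dotp_norm dot_suml mulr2n.
congr (_ - _ + _).
  rewrite -mulr2n -[LHS]mulr_natl; congr (_ * _).
  by apply: eq_bigr => i _; rewrite dotZr mulrC.
apply: eq_bigr => i _; rewrite dot_sumr; apply: eq_bigr => j _.
by rewrite dotZl dotZr; ring.
Qed.

(** One computation for both sides of the Ito isometry: the [f i] are values of
    the Wiener process on one side and indicators of time intervals on the other. *)
Lemma integral_bilinear d (T : measurableType d) (mu : {measure set T -> \bar R})
    (D : set T) n (f : 'I_n -> T -> R) (g K : 'I_n -> 'I_n -> R) : measurable D ->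
  (forall i j, mu.-integrable D (fun x => (f i x * f j x)%:E)) ->
  (forall i j, \int[mu]_(x in D) (f i x * f j x)%:E = (g i j)%:E)%E ->
  let q x := \sum_(i < n) \sum_(j < n) K i j * (f i x * f j x) in
  mu.-integrable D (EFin \o q) /\
  (\int[mu]_(x in D) (q x)%:E = (\sum_(i < n) \sum_(j < n) K i j * g i j)%:E)%E.
Proof.
move=> mD fi fg q.
have i2 i j : mu.-integrable D (fun x => (K i j * (f i x * f j x))%:E).
  by under eq_fun do rewrite EFinM; apply: integrableZl.
have i1 i : mu.-integrable D (fun x => (\sum_(j < n) K i j * (f i x * f j x))%:E).
  by under eq_fun do rewrite -sumEFin; apply: integrable_sum.
have qE : EFin \o q = fun x => (\sum_(i < n) (\sum_(j < n) K i j * (f i x * f j x))%:E)%E.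
  by apply/funext => x; rewrite sumEFin.
split; first by rewrite qE; exact: integrable_sum.
rewrite (eq_integral (fun x => \sum_(i < n) (\sum_(j < n) K i j * (f i x * f j x))%:E)%E).
  rewrite integral_sum// -sumEFin; apply: eq_bigr => i _.
  rewrite (eq_integral (fun x => \sum_(j < n) (K i j * (f i x * f j x))%:E)%E).
    rewrite integral_sum// -sumEFin; apply: eq_bigr => j _.
    by under eq_integral do rewrite EFinM; rewrite integralZl// fg -EFinM.
  by move=> x _; rewrite sumEFin.
by move=> x _; rewrite sumEFin.
Qed.

End finite_sums.

Section step_integrands.
Context (R : realType) (X Y : hilbertType R) (Y_sep : separable Y).
Context (n : nat) (a : 'I_n -> R) (y : 'I_n -> Y) (x : 'I_n -> X) (t : R).
Hypothesis at_ : forall i, 0 <= a i <= t.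

Let ind i (s : R) : R := \1_(`]0, a i]%classic) s.

(** All time intervals start at 0: the product of two indicators then has the
    integral [min (a i) (a j)], as in the covariance of the Wiener process. *)
Definition step_integrand (s : R) (z : Y) : X :=
  \sum_(i < n) (ind i s * '[y i, z]) *: x i.

Lemma hs_norm2_step s : hs_norm2 (step_integrand s) =
  (\sum_(i < n) \sum_(j < n) '[y i, y j] * '[x i, x j] * (ind i s * ind j s))%:E.
Proof.
have [e [eO eT ee]] := onb_enum Y_sep.
rewrite /hs_norm2 ee => [|z|]; last first.
- rewrite /step_integrand big1 ?normr0 ?expr0n// => i _.
  by rewrite dot0r mulr0 scale0r.
- by rewrite lee_fin sqr_ge0.
apply: eseries_EFin.
rewrite (_ : series _ = fun m => \sum_(i < n) \sum_(j < n)
  '[x i, x j] * (ind i s * ind j s) * series (fun k => '[y i, e k] * '[y j, e k]) m).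
  rewrite (_ : \sum_(_ < _) _ = \sum_(i < n) \sum_(j < n)
      '[x i, x j] * (ind i s * ind j s) * '[y i, y j]); last first.
    by apply: eq_bigr => i _; apply: eq_bigr => j _; ring.
  apply: (@cvg_bigsum _ R^o) => i; apply: (@cvg_bigsum _ R^o) => j.
  by apply: cvgMr; exact: cvg_parseval_dot.
apply/funext => m; rewrite /series/=.
transitivity (\sum_(0 <= k < m) \sum_(i < n) \sum_(j < n)
    '[x i, x j] * (ind i s * ind j s) * ('[y i, e k] * '[y j, e k])).
  apply: eq_bigr => k _; rewrite -normrN -sub0r norm_sqr_sum normr0 expr0n/=.
  rewrite big1 => [|i _]; last by rewrite dot0l mul0r.
  rewrite mulr0 subrr add0r; apply: eq_bigr => i _; apply: eq_bigr => j _; ring.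
rewrite exchange_big/=; apply: eq_bigr => i _.
rewrite exchange_big/=; apply: eq_bigr => j _.
by rewrite mulr_sumr.
Qed.

Let indM i j s : ind i s * ind j s = \1_(`]0, Num.min (a i) (a j)]%classic) s.
Proof.
rewrite /ind -[LHS]/((\1_(`]0, a i]%classic) \* \1_(`]0, a j]%classic)) s) -indicI.
congr (\1_ _ s); apply/seteqP; split=> z /=; rewrite !in_itv/= le_min.
  by move=> [/andP[-> ->] /andP[_ ->]].
by move=> /and3P[-> -> ->].
Qed.

Lemma integral_hs_norm2_step :
  (\int[lebesgue_measure]_(s in `[0%R, t]) hs_norm2 (step_integrand s) =
   (\sum_(i < n) \sum_(j < n) '[y i, y j] * '[x i, x j] * Num.min (a i) (a j))%:E)%E.
Proof.
under eq_integral do rewrite hs_norm2_step.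
have m0 i j : 0 <= Num.min (a i) (a j) <= t.
  have /andP[ai0 ait] := at_ i; have /andP[aj0 ajt] := at_ j.
  by rewrite le_min ai0 aj0/= ge_min ait.
have [] := @integral_bilinear R _ (measurableTypeR R) lebesgue_measure `[0%R, t] n ind
  (fun i j => Num.min (a i) (a j)) (fun i j => '[y i, y j] * '[x i, x j]) => //.
- move=> i j; rewrite (_ : (fun s => _) =
    (fun s : measurableTypeR R => (\1_(`]0%R, Num.min (a i) (a j)]%classic) s)%:E)).
    by apply: (integrableS measurableT) => //; exact: integrable_indic_itv.
  by apply/funext => s; rewrite -indM.
- move=> i j; rewrite (eq_integral
    (fun s : measurableTypeR R => (\1_(`]0%R, Num.min (a i) (a j)]%classic) s)%:E)).
    have /andP[h0 ht] := m0 i j.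
    rewrite integral_indic//= setIidl.
      rewrite lebesgue_measure_itv/= lte_fin sube0.
      by move: h0; rewrite le_eqVlt => /predU1P[<-|->//]; rewrite ltxx.
    move=> z /=; rewrite !in_itv/= => /andP[z0 zm].
    by rewrite (ltW z0) (le_trans zm).
  by move=> s _; rewrite -indM.
Qed.

Lemma measurable_hs_norm2_stepB (F : Y -> X) : F 0 = 0 ->
  measurable_fun (`[0%R, t] : set R)
    (fun s => hs_norm2 (fun z => step_integrand s z - F z)).
Proof.
move=> F0; have [e [eO eT ee]] := onb_enum Y_sep.
have step0 s : step_integrand s 0 = 0.
  by rewrite /step_integrand big1// => i _; rewrite dot0r mulr0 scale0r.
rewrite (_ : (fun s => _) = (fun s =>
    \sum_(0 <= k <oo) (`|step_integrand s (e k) - F (e k)| ^+ 2)%:E)%E); last first.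
  apply/funext => s; rewrite /hs_norm2 ee//.
  by rewrite step0 F0 subrr normr0 expr0n.
apply: ge0_emeasurable_sum => [k s _ _|k _]; first by rewrite lee_fin sqr_ge0.
apply/measurable_EFinP.
have mi i : measurable_fun (`[0%R, t] : set R) (ind i).
  by apply: measurable_indic; exact: measurable_itv.
rewrite (_ : (fun s => _) = (fun s => `|F (e k)| ^+ 2 -
    2 * (\sum_(i < n) '[F (e k), x i] * (ind i s * '[y i, e k])) +
    \sum_(i < n) \sum_(j < n) '[x i, x j] *
      ((ind i s * '[y i, e k]) * (ind j s * '[y j, e k])))); last first.
  by apply/funext => s; rewrite distrC norm_sqr_sum.
apply: measurable_funD.
  apply: measurable_funB => //; apply: measurable_funM => //.
  apply: measurable_sum => i; apply: measurable_funM => //.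
  by apply: measurable_funM.
apply: measurable_sum => i; apply: measurable_sum => j; apply: measurable_funM => //.
by apply: measurable_funM; apply: measurable_funM.
Qed.

End step_integrands.

Section elementary_integrands.
Context (R : realType) (X Y : hilbertType R).

(** The increment over (lo, hi] is the difference of two increments starting at
    time 0, which reduces covariances of increments to covariances of W. *)
Lemma elementary_step (t : R) (l : seq (piece X Y)) :
  seq.all (fun k => [&& 0 <= lo k, lo k <= hi k & hi k <= t]) l ->
  exists n (a : 'I_n -> R) (y : 'I_n -> Y) (x : 'I_n -> X),
  [/\ forall i, 0 <= a i <= t, forall s z, elementary l s z = step_integrand a y x s z &
    forall d (Om : measurableType d) (P : probability Om R)
      (W : R -> Y -> {RV P >-> R}) w,
      elementary_integral W l w = \sum_(i < n) W (a i) (y i) w *: x i].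
Proof.
move=> lP.
pose r : seq (R * Y * X) :=
  flatten [seq [:: (hi k, dir k, Defs.val k); (lo k, dir k, - Defs.val k)] | k <- l].
have rE (V : nmodType) (f : R * Y * X -> V) : \sum_(j <- r) f j =
    \sum_(k <- l) (f (hi k, dir k, Defs.val k) + f (lo k, dir k, - Defs.val k)).
  rewrite big_flatten big_map; apply: eq_bigr => k _.
  by rewrite !big_cons big_nil /= addr0.
exists (size r), (fun i => (tnth (in_tuple r) i).1.1),
  (fun i => (tnth (in_tuple r) i).1.2), (fun i => (tnth (in_tuple r) i).2).
split.
- apply/(@all_tnthP _ _ (fun j => 0 <= j.1.1 <= t) (in_tuple r)).
  rewrite /r/=; elim: (l) lP => //= k l' IH /andP[/and3P[k0 k1 k2] /IH ->].
  by rewrite (le_trans k0 k1) k2 k0 (le_trans k1 k2).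
- move=> s z; rewrite /step_integrand /elementary.
  rewrite -(big_tnth _ _ r predT (fun j => (\1_(`]0, j.1.1]%classic) s * '[j.1.2, z]) *: j.2)).
  rewrite rE; elim: (l) lP => [_|k l' IH /= /andP[/and3P[k0 k1 k2] /IH e]].
    by rewrite !big_nil.
  rewrite !big_cons -e/= scalerN -scalerBl -mulrBl; congr (_ * _ *: _ + _).
  rewrite !indicE !mem_setE !in_itv/=.
  case: (ltP (lo k) s) => h1; case: (leP s (hi k)) => h2; case: (ltP 0 s) => h3 /=;
    rewrite ?subrr ?subr0//; lra.
- move=> d Om P W w; rewrite /elementary_integral.
  rewrite -(big_tnth _ _ r predT (fun j => W j.1.1 j.1.2 w *: j.2)) rE.
  by apply: eq_bigr => k _ /=; rewrite scalerN -scalerBl.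
Qed.

Lemma hs_norm2_triangle (Y_sep : separable Y) (F G : Y -> X) (dl : R) : 0 < dl ->
  F 0 = 0 -> G 0 = 0 ->
  (hs_norm2 F <= (1 + dl)%:E * hs_norm2 G +
     (1 + dl^-1)%:E * hs_norm2 (fun z => (F z - G z)%R))%E.
Proof.
move=> d0 F0 G0; have [e [eO eT ee]] := onb_enum Y_sep.
have s0 (K : Y -> X) z : (0 <= (`|K z| ^+ 2)%:E)%E by rewrite lee_fin sqr_ge0.
have z0 (K : Y -> X) : K 0 = 0 -> (`|K 0| ^+ 2)%:E = 0%E.
  by move=> ->; rewrite normr0 expr0n.
have d1 : 0 <= 1 + dl by lra.
have d2 : 0 <= 1 + dl^-1 by rewrite addr_ge0// invr_ge0 ltW.
have FG0 : (`|F 0 - G 0| ^+ 2)%:E = 0%E.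
  by rewrite F0 G0 subrr normr0 expr0n.
rewrite /hs_norm2 !ee//; try (apply: s0 || exact: z0).
rewrite -!nneseriesZl// -nneseriesD; first last.
- by move=> i _ _; rewrite mule_ge0// lee_fin.
- by move=> i _ _; rewrite mule_ge0// lee_fin.
apply: lee_nneseries => // i _; rewrite -!EFinM -EFinD lee_fin.
have -> : F (e i) = G (e i) + (F (e i) - G (e i)) by rewrite addrC subrK.
by rewrite [X in _ + _ * `|X| ^+ 2]addrC addKr norm_sqrD_le.
Qed.

End elementary_integrands.

(** * The Wiener integral *)

Section random_elements.
Context (R : realType) (d : measure_display) (Om : measurableType d).
Context (P : probability Om R).

Lemma expectationE (f : Om -> R) : ('E_P[f] = \int[P]_w (f w)%:E)%E.
Proof. by rewrite unlock. Qed.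

Lemma random_element_comp (X : topologicalType) (Z : Om -> X) (g : X -> R) :
  random_element Z -> continuous g -> measurable_fun setT (g \o Z).
Proof.
move=> mZ /continuousP cg; apply: (measurability _ (RGenOpens.measurableE R)).
move=> _ [_ [a [b ->] <-]]; rewrite setTI.
by apply: (mZ (g @^-1` `]a, b[%classic)); apply: cg; exact: interval_open.
Qed.

End random_elements.

Section wiener_isometry.
Context (R : realType) (d : measure_display) (Om : measurableType d).
Context (P : probability Om R) (X Y : hilbertType R) (Y_sep : separable Y).
Context (T : R) (W : R -> Y -> {RV P >-> R}).
Hypothesis WP : cylindrical_wiener T W.

(** The covariance at equal arguments is a finite second moment. *)
Lemma integrable_wiener_mul s t y y' : 0 <= s <= T -> 0 <= t <= T ->
  P.-integrable setT (fun w => (W s y w * W t y' w)%:E).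
Proof.
move=> sT tT.
have sq s' z : 0 <= s' <= T -> P.-integrable setT (fun w => (W s' z w * W s' z w)%:E).
  move=> s'T; apply/integrableP; split.
    by apply/measurable_EFinP; apply: measurable_funM.
  have := wiener_covariance WP z z s'T s'T; rewrite expectationE => h.
  under eq_integral do rewrite gee0_abs ?lee_fin ?sqr_ge0 -?expr2//.
  rewrite (_ : (\int[P]_w _)%E = (\int[P]_w (W s' z w * W s' z w)%:E)%E).
    by rewrite h ltry.
  by apply: eq_integral => w _; rewrite expr2.
have := integrableD measurableT (sq s y sT) (sq t y' tT).
apply: le_integrable => //.
  by apply/measurable_EFinP; apply: measurable_funM.
move=> w _; rewrite -EFinD/= lee_fin [leRHS]ger0_norm; last first.
  by rewrite addr_ge0// -expr2 sqr_ge0.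
rewrite -!expr2 normrM -(real_normK (num_real (W s y w))) -(real_normK (num_real (W t y' w))).
set a := `|W s _ _|; set b := `|W t _ _|.
have := sqr_ge0 (a - b); have : 0 <= a * b by rewrite /a /b mulr_ge0.
rewrite sqrrB => h1 h2.
have : a ^+ 2 + b ^+ 2 - a * b = a ^+ 2 - a * b *+ 2 + b ^+ 2 + a * b by ring.
by move=> e; rewrite -subr_ge0 e addr_ge0.
Qed.

Lemma integrable_wiener s y : 0 <= s <= T ->
  P.-integrable setT (fun w => (W s y w)%:E).
Proof.
move=> sT.
have h1 : P.-integrable setT (EFin \o cst (1 : R)).
  exact: finite_measure_integrable_cst.
have := integrableD measurableT h1 (integrable_wiener_mul y y sT sT).
apply: le_integrable => //; first by apply/measurable_EFinP.
move=> w _; rewrite -EFinD/= lee_fin [leRHS]ger0_norm; last first.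
  by rewrite addr_ge0// -expr2 sqr_ge0.
rewrite -!expr2 -(real_normK (num_real (W s y w))).
set a := `|_|; have := sqr_ge0 (a - 1); have : 0 <= a by rewrite /a.
rewrite sqrrB mulr1 expr1n; lra.
Qed.

Section finite_family.
Context (n : nat) (a : 'I_n -> R) (y : 'I_n -> Y) (x : 'I_n -> X) (t : R) (b : X).
Hypothesis at_ : forall i, 0 <= a i <= t.
Hypothesis tT : t <= T.

Let aT i : 0 <= a i <= T.
Proof. by have /andP[-> h] := at_ i; rewrite (le_trans h). Qed.

(** The Ito isometry. The cross term with [b] vanishes because the Wiener process
    is centred; this is why bias and noise add up with constant 1. *)
Lemma wiener_step_isometry :
  ('E_P[fun w => (`|b - \sum_(i < n) W (a i) (y i) w *: x i| ^+ 2)%R] =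
   (`|b| ^+ 2)%:E + \int[lebesgue_measure]_(s in `[0%R, t])
       hs_norm2 (step_integrand a y x s))%E.
Proof.
rewrite (integral_hs_norm2_step Y_sep) // expectationE.
pose K i j := '[x i, x j].
pose g i j := Num.min (a i) (a j) * '[y i, y j].
have [||qi qE] := @integral_bilinear R _ _ P setT n (fun i => W (a i) (y i)) g K measurableT.
- by move=> i j; exact: integrable_wiener_mul.
- by move=> i j; rewrite -(wiener_covariance WP)// expectationE.
set q := (fun w => _) in qi qE.
pose L w := \sum_(i < n) '[b, x i] * W (a i) (y i) w.
have Li i : P.-integrable setT (fun w => ('[b, x i] * W (a i) (y i) w)%:E).
  by under eq_fun do rewrite EFinM; apply: integrableZl => //; exact: integrable_wiener.
have iL : P.-integrable setT (EFin \o L).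
  rewrite (_ : EFin \o L = fun w => (\sum_(i < n) ('[b, x i] * W (a i) (y i) w)%:E)%E).
    exact: integrable_sum.
  by apply/funext => w; rewrite sumEFin.
have eL : (\int[P]_w (L w)%:E = 0)%E.
  rewrite (eq_integral (fun w => \sum_(i < n) ('[b, x i] * W (a i) (y i) w)%:E)%E).
    rewrite integral_sum// big1// => i _.
    under eq_integral do rewrite EFinM.
    rewrite integralZl//; last exact: integrable_wiener.
    by rewrite -expectationE (wiener_mean WP)// mule0.
  by move=> w _; rewrite sumEFin.
pose bb : R := `|b| ^+ 2.
have ib : P.-integrable setT (EFin \o cst bb).
  exact: finite_measure_integrable_cst.
have iL2 : P.-integrable setT (fun w => ((-2)%:E * (EFin \o L) w)%E).
  exact: integrableZl.
rewrite (eq_integral (fun w => (EFin \o cst bb) w + (-2)%:E * (EFin \o L) w +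
   (EFin \o q) w)%E); last first.
  move=> w _; rewrite norm_sqr_sum/= -EFinM -!EFinD; congr (_%:E).
  by rewrite mulNr.
rewrite integralD//; last exact: integrableD.
rewrite integralD// integralZl// eL mule0 adde0 qE.
congr (_ + _%:E)%E; first by rewrite (integral_cst P measurableT bb%:E) [X in (_ * X)%E](@probability_setT _ _ _ P) mule1.
by apply: eq_bigr => i _; apply: eq_bigr => j _; rewrite /K /g; ring.
Qed.

End finite_family.

(** Passage of the isometry to the L2 limit. Replacing [J] and [Phi] by their
    elementary approximations costs a factor [1 + dl] on the main terms and
    errors tending to 0 with [n]; first [n] tends to infinity, then [dl] to 0. *)
Lemma wiener_integral_le (t : R) (Psi : R -> Y -> X) (Phi : Y -> X) (J : Om -> X) (b : X) :
  0 < t -> t <= T -> Phi 0 = 0 ->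
  (forall s, 0 <= s <= t -> Psi s =1 Phi) ->
  is_wiener_integral W t Psi J ->
  ('E_P[fun w => (`|b - J w| ^+ 2)%R] <= (`|b| ^+ 2)%:E + t%:E * hs_norm2 Phi)%E.
Proof.
move=> t0 tT Phi0 PsiPhi [mJ [l [lP lPsi lJ]]].
have hs0 (F : Y -> X) : (0 <= hs_norm2 F)%E.
  by apply: esum_ge0 => e _; rewrite lee_fin sqr_ge0.
pose D n := (\int[lebesgue_measure]_(s in `[0%R, t])
   hs_norm2 (fun z => (elementary (l n) s z - Psi s z)%R))%E.
pose r n := ('E_P[fun w => (`|J w - elementary_integral W (l n) w| ^+ 2)%R])%E.
have bound (dl : R) n : 0 < dl ->
  ('E_P[fun w => (`|b - J w| ^+ 2)%R] <= (1 + dl)%:E * ((`|b| ^+ 2)%:E +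
     ((1 + dl)%:E * (t%:E * hs_norm2 Phi) + (1 + dl^-1)%:E * D n)) + (1 + dl^-1)%:E * r n)%E.
  move=> d0; have d1 : 0 <= 1 + dl by lra.
  have d2 : 0 <= 1 + dl^-1 by rewrite addr_ge0// invr_ge0 ltW.
  have [N [a [y [x [at_ lE IE]]]]] := elementary_step (lP n).
  have {}IE := IE d Om P W.
  have step0 s : step_integrand a y x s 0 = 0.
    by rewrite /step_integrand big1// => i _; rewrite dot0r mulr0 scale0r.
  have m1 : measurable_fun setT (fun w => (`|b - J w| ^+ 2)).
    apply: (random_element_comp (g := fun z => `|b - z| ^+ 2) mJ).
    move=> z; rewrite /continuous_at expr2.
    by apply: cvgM; apply: cvg_norm; apply: cvgB => //; exact: cvg_cst.
  have m2 : measurable_fun setT (fun w => `|b - elementary_integral W (l n) w| ^+ 2).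
    under eq_fun do rewrite IE norm_sqr_sum.
    apply: measurable_funD.
      apply: measurable_funB => //; apply: measurable_funM => //.
      by apply: measurable_sum => i; apply: measurable_funM.
    apply: measurable_sum => i; apply: measurable_sum => j.
    by apply: measurable_funM => //; apply: measurable_funM.
  have m3 : measurable_fun setT (fun w => `|J w - elementary_integral W (l n) w| ^+ 2).
    under eq_fun do rewrite IE norm_sqr_sum.
    apply: measurable_funD.
      apply: measurable_funB.
        apply: (random_element_comp (g := fun z => `|z| ^+ 2) mJ).
        by move=> z; rewrite /continuous_at expr2; apply: cvgM; apply: cvg_norm.
      apply: measurable_funM => //; apply: measurable_sum => i.
      apply: measurable_funM => //.
      apply: (random_element_comp (g := fun z => '[z, x i]) mJ) => z.
      exact: cvg_dotl.
    apply: measurable_sum => i; apply: measurable_sum => j.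
    by apply: measurable_funM => //; apply: measurable_funM.
  apply: (@le_trans _ _ ((1 + dl)%:E *
      'E_P[fun w => (`|b - elementary_integral W (l n) w| ^+ 2)%R] +
      (1 + dl^-1)%:E * r n)%E).
    rewrite /r !expectationE.
    rewrite -!ge0_integralZl_EFin//; try by [move=> *; rewrite lee_fin sqr_ge0|exact/measurable_EFinP].
    rewrite -ge0_integralD//; first last.
    - by apply/measurable_EFinP; apply: measurable_funM.
    - by move=> w _; rewrite -EFinM lee_fin mulr_ge0// sqr_ge0.
    - by apply/measurable_EFinP; apply: measurable_funM.
    - by move=> w _; rewrite -EFinM lee_fin mulr_ge0// sqr_ge0.
    apply: ge0_le_integral => //.
    - exact/measurable_EFinP.
    - apply: emeasurable_funD; apply/measurable_EFinP; exact: measurable_funM.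
    - move=> w _; rewrite -!EFinM -EFinD lee_fin (distrC (J w)).
      rewrite -[X in `|X| ^+ 2 <= _](subrKA (elementary_integral W (l n) w)).
      exact: norm_sqrD_le.
  rewrite leeD2r// lee_wpmul2l ?lee_fin//.
  rewrite (_ : (fun w => _) = (fun w =>
      `|b - \sum_(i < N) W (a i) (y i) w *: x i| ^+ 2)); last first.
    by apply/funext => w; rewrite IE.
  rewrite (wiener_step_isometry _ _ _ at_ tT) leeD2l//.
  have mB := measurable_hs_norm2_stepB Y_sep a y x (t := t) Phi0.
  have mS : measurable_fun (`[0%R, t] : set R) (fun s => hs_norm2 (step_integrand a y x s)).
    have := measurable_hs_norm2_stepB Y_sep a y x (t := t) (F := fun=> 0) erefl.
    by congr (measurable_fun _ _); apply/funext => s; congr (hs_norm2 _); apply/funext => z; rewrite subr0.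
  have -> : D n = (\int[lebesgue_measure]_(s in `[0%R, t])
      hs_norm2 (fun z => (step_integrand a y x s z - Phi z)%R))%E.
    apply: eq_integral => s; rewrite inE/= in_itv/= => sT; congr (hs_norm2 _).
    by apply/funext => z; rewrite lE PsiPhi.
  have -> : (t%:E * hs_norm2 Phi = \int[lebesgue_measure]_(s in `[0%R, t]) hs_norm2 Phi)%E.
    rewrite integral_cst// muleC; congr (_ * _)%E; apply/esym.
    apply: etrans (lebesgue_measure_itv `[0, t]) _.
    by rewrite /= lte_fin t0 sube0.
  rewrite -!ge0_integralZl_EFin// -ge0_integralD//; first last.
  - exact: measurable_funeM.
  - by move=> s _; rewrite mule_ge0// lee_fin.
  - by move=> s _; rewrite mule_ge0// lee_fin.
  apply: ge0_le_integral => //.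
    by apply: emeasurable_funD; exact: measurable_funeM.
  by move=> s _; apply: hs_norm2_triangle.
have [hsoo|hsfin] := eqVneq (hs_norm2 Phi) +oo%E.
  by rewrite hsoo gt0_muley ?lte_fin// addey ?leey.
have hsf : hs_norm2 Phi \is a fin_num by rewrite ge0_fin_numE// ltey.
set c := t * fine (hs_norm2 Phi).
have cE : (t%:E * hs_norm2 Phi = c%:E)%E by rewrite -(fineK hsf) -EFinM.
have c0 : 0 <= c by rewrite mulr_ge0 ?(ltW t0)// fine_ge0.
rewrite cE -EFinD; apply/lee_addgt0Pr => e e0; rewrite -EFinD.
set bb := `|b| ^+ 2; have bb0 : 0 <= bb by rewrite sqr_ge0.
(* With this dl the factors 1 + dl cost at most e / 2, and with eta below the
   approximation errors cost at most e / 2. *)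
set dl := Num.min 1 (e / (6 * (bb + c + 1))).
have S0 : 0 < 6 * (bb + c + 1) by lra.
have dl0 : 0 < dl by rewrite lt_min ltr01 divr_gt0.
have dl1 : dl <= 1 by rewrite ge_min lexx.
have dle : dl * (6 * (bb + c + 1)) <= e by rewrite -ler_pdivlMr// ge_min lexx orbT.
have k0 : 0 < 1 + dl^-1 by rewrite ltr_wpDr// invr_ge0 ltW.
set eta := e / (6 * (1 + dl^-1)).
have eta0 : 0 < eta by rewrite divr_gt0// mulr_gt0.
have small (u : nat -> \bar R) : u @ \oo --> 0%E -> \forall n \near \oo, (u n <= eta%:E)%E.
  move=> /fine_cvgP[fu /cvgr0Pnorm_le/(_ _ eta0)].
  move=> h; apply: filterS2 fu h => n fn; rewrite -[in X in _ -> X](fineK fn) lee_fin.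
  exact/le_trans/ler_norm.
have [n _ /(_ n (leqnn n))[Dn rn]] := filterI (small _ lPsi) (small _ lJ).
apply: (le_trans (bound _ n dl0)); rewrite cE.
apply: (@le_trans _ _ ((1 + dl)%:E * (bb%:E + ((1 + dl)%:E * c%:E +
   (1 + dl^-1)%:E * eta%:E)) + (1 + dl^-1)%:E * eta%:E)%E).
  apply: leeD; last by rewrite lee_wpmul2l ?lee_fin// ltW.
  rewrite lee_wpmul2l ?lee_fin//; first lra.
  by rewrite leeD2l// leeD2l// lee_wpmul2l ?lee_fin// ltW.
rewrite -?EFinM -?EFinD -?EFinM -?EFinD lee_fin.
have -> : (1 + dl^-1) * eta = e / 6 by rewrite /eta; field; rewrite !gt_eqF//; lra.
nra.
Qed.

End wiener_isometry.

(** * Normal operators, square roots and scalar inequalities *)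

Section normal_operator.
Context (R : realType) (X Y : hilbertType R) (X_sep : separable X) (K : X -> Y).
Hypothesis KD : forall x y, K (x + y) = K x + K y.
Hypothesis KZ : forall c x, K (c *: x) = c *: K x.
Context (M : R).
Hypothesis K_bound : forall x, `|K x| <= M * `|x|.

Let KK := adjoint K \o K.

Lemma dot_normal x y : '[KK x, y] = '[K x, K y].
Proof. by rewrite dotC -(adjoint_dot X_sep KD KZ K_bound) dotC. Qed.

Lemma normalD x y : KK (x + y) = KK x + KK y.
Proof. by apply: dot_eq => z; rewrite dotDl !dot_normal KD dotDl. Qed.

Lemma normalZ c x : KK (c *: x) = c *: KK x.
Proof. by apply: dot_eq => z; rewrite dotZl !dot_normal KZ dotZl. Qed.

Lemma normal_self_adjoint : self_adjoint KK.
Proof. by move=> x y; rewrite dot_normal (dotC x) dot_normal dotC. Qed.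

Lemma normal_ge0 x : 0 <= '[x, KK x].
Proof. by rewrite dotC dot_normal dotp_norm sqr_ge0. Qed.

Lemma normal_le1 : (forall x, `|K x| <= `|x|) -> forall x, `|KK x| <= `|x|.
Proof.
move=> K1 x.
have [->|n0] := eqVneq (KK x) 0; first by rewrite normr0.
have n1 : 0 < `|KK x| by rewrite normr_gt0.
rewrite -(ler_pM2l n1) -expr2 -dotp_norm dot_normal.
rewrite (le_trans (ler_norm _))// (le_trans (cauchy_schwarz _ _))// mulrC.
by rewrite ler_pM.
Qed.

End normal_operator.

Section square_roots.
Context (R : realType) (H : hilbertType R).

Lemma sqrt_inj (F : H -> H) (S : {linear H -> H}) :
  is_sqrt F S -> positive_definite F -> injective S.
Proof.
move=> SF Fpd a b ab; apply/eqP; rewrite -subr_eq0; apply/negPn/negP => /Fpd.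
by rewrite -(sqrtK SF) linearB ab subrr linear0 dot0r ltxx.
Qed.

(** On [w = S v - sqrt m v] the operator [S] acts as [- sqrt m], which positivity
    of [S] forbids unless [w = 0]. *)
Lemma sqrt_eigen (F : H -> H) (S : {linear H -> H}) (m : R) (v : H) :
  is_sqrt F S -> 0 <= m -> F v = m *: v -> S v = Num.sqrt m *: v.
Proof.
move=> SF m0 Fv; set r := Num.sqrt m; have r0 : 0 <= r by exact: sqrtr_ge0.
have rr : r * r = m by rewrite -expr2 sqr_sqrtr.
apply/eqP; rewrite -subr_eq0; set w := S v - r *: v.
have Sw : S w = - r *: w.
  rewrite /w linearB linearZ/= (sqrtK SF) Fv scaleNr scalerBr scalerA rr opprB.
  by [].
have [r00|rn0] := eqVneq r 0.
  have w0 : w = S v by rewrite /w r00 scale0r subr0.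
  have : '[w, w] = 0.
    by rewrite {1}w0 (sqrt_self_adjoint SF) Sw r00 oppr0 scale0r dot0r.
  by rewrite dotp_norm => /eqP; rewrite sqrf_eq0 normr_eq0.
have := sqrt_ge0 SF w; rewrite Sw dotZr mulNr oppr_ge0 pmulr_rle0 ?lt_def ?rn0//.
rewrite dotp_norm => h; rewrite -normr_eq0 -sqrf_eq0.
by rewrite eq_le h sqr_ge0.
Qed.

End square_roots.

Section scalar_bounds.
Context (R : realType) (p : R).
Hypothesis p0 : 0 < p.

Let p1 : 0 < p + 1. Proof. by rewrite addr_gt0. Qed.

Lemma powR_le1D (x q : R) : 0 <= x -> 0 <= q <= 1 -> x `^ q <= 1 + x.
Proof.
move=> x0 /andP[q0 q1]; have [x1|x1] := leP x 1.
  apply: (@le_trans _ _ (1 `^ q)); last by rewrite powR1 lerDl.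
  by apply: ge0_ler_powR => //; rewrite nnegrE.
rewrite (@le_trans _ _ x)// ?lerDr//.
by rewrite -[leRHS]powRr1// ler_powR// ltW.
Qed.

Lemma powRS_mul (l : R) : 0 <= l -> l * l `^ p = l `^ (p + 1).
Proof.
move=> l0; rewrite addrC powRD ?powRr1//.
by rewrite addrC gt_eqF.
Qed.

(** With [x = t l^(p+1) / alpha] and [q = p / (p + 1)], this reads
    [x^q <= 1 + x]. *)
Lemma variance_scalar (alpha t l : R) : 0 < alpha -> 0 < t -> 0 <= l ->
  l `^ p / (alpha + t * l `^ (p + 1)) <=
  alpha `^ (- (p + 1)^-1) * t `^ (- (p / (p + 1))).
Proof.
move=> a0 t0 l0; set s := l `^ (p + 1); have s0 : 0 <= s by exact: powR_ge0.
rewrite ler_pdivrMr; last by rewrite ltr_wpDr// mulr_ge0// ltW.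
set q := p / (p + 1); have q01 : 0 <= q <= 1.
  by rewrite divr_ge0 ?(ltW p0) ?(ltW p1)//= /q ler_pdivrMr// mul1r lerDl.
have -> : l `^ p = s `^ q by rewrite /s -powRrM /q mulrC divfK// gt_eqF.
have xs : s = (alpha / t) * (t * s / alpha) by field; rewrite !gt_eqF.
have x0 : 0 <= t * s / alpha by rewrite divr_ge0 ?mulr_ge0 ?(ltW t0) ?(ltW a0).
rewrite [in leLHS]xs (powRM _ (divr_ge0 (ltW a0) (ltW t0)) x0).
have -> : alpha `^ (- (p + 1)^-1) * t `^ (- q) * (alpha + t * s) =
    (alpha / t) `^ q * (1 + t * s / alpha).
  have -> : alpha + t * s = alpha * (1 + t * s / alpha) by field; rewrite gt_eqF.
  rewrite mulrA; congr (_ * _).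
  have ti : t^-1 `^ q = t `^ (- q) by rewrite -powR_inv1 ?(ltW t0)// -powRrM mulN1r.
  rewrite powRM ?invr_ge0 ?(ltW t0) ?(ltW a0)// ti mulrAC.
  congr (_ * _); rewrite -{2}(powRr1 (ltW a0)) -powRD; last first.
    by rewrite (gt_eqF a0) implybT.
  by congr (_ `^ _); rewrite /q; field; rewrite gt_eqF.
by rewrite ler_wpM2l ?powR_ge0// powR_le1D.
Qed.

(** Below [s = (alpha / t)^(1 / (p+1))] monotonicity of [phi] suffices. Above [s]
    the decrease of [phi l / l^(p+1)] bounds [phi l] by [phi s] times
    [t l^(p+1) / alpha], a growth which the first factor compensates. *)
Lemma bias_scalar (phi : R -> R) (alpha t l : R) : index_function phi ->
  (forall l l', 0 < l -> l <= l' ->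
      phi l' / l' `^ (p + 1) <= phi l / l `^ (p + 1)) ->
  0 < alpha -> 0 < t -> 0 <= l ->
  alpha / (alpha + t * l `^ (p + 1)) * phi l <= phi ((alpha / t) `^ (p + 1)^-1).
Proof.
move=> ip dec a0 t0; rewrite le_eqVlt => /predU1P[<-|l0].
  rewrite (index_at0 ip) mulr0 ltW// (index_gt0 ip)// powR_gt0// divr_gt0//.
set s := (alpha / t) `^ _; have at0 : 0 < alpha / t by rewrite divr_gt0.
have s0 : 0 < s by rewrite powR_gt0.
have sE : s `^ (p + 1) = alpha / t by rewrite /s -powRrM mulVf ?gt_eqF// powRr1// ltW.
set sg := l `^ (p + 1); have sg0 : 0 < sg by rewrite powR_gt0.
have d0 : 0 < alpha + t * sg by rewrite addr_gt0// mulr_gt0.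
have [ls|sl] := leP l s.
  rewrite (le_trans _ (index_nondecreasing ip l0 ls))// ler_piMl ?ltW ?(index_gt0 ip)//.
  by rewrite ltr_pdivrMr// mul1r ltrDl mulr_gt0.
have := dec _ _ s0 (ltW sl); rewrite sE -/sg => h.
have {}h : phi l <= phi s * (t * sg / alpha).
  move: h; rewrite ler_pdivrMr// => /le_trans; apply.
  by rewrite le_eqVlt; apply/orP; left; apply/eqP; field; rewrite !gt_eqF.
have phs := index_gt0 ip s0.
apply: (@le_trans _ _ (alpha / (alpha + t * sg) * (phi s * (t * sg / alpha)))).
  by rewrite ler_wpM2l// divr_ge0 ?ltW.
rewrite (_ : _ * _ = phi s * (t * sg / (alpha + t * sg))); last first.
  by field; rewrite !gt_eqF.
rewrite ler_piMr ?(ltW phs)// ler_pdivrMr// mul1r lerDr ltW//.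
Qed.

(** Away from 0, [phi l] is at most [phi 1] and [l^(p+1)] is bounded below. *)
Lemma index_le_powR (phi : R -> R) : index_function phi ->
  (exists c : R, \forall l \near 0^'+, phi l <= c * l `^ (p + 1)) ->
  exists2 c : R, 0 <= c & forall l, 0 <= l <= 1 -> phi l <= c * l `^ (p + 1).
Proof.
move=> ip [c /nbhs_ballP[dl /= dl0 h]].
have r0 : 0 < (dl / 2) `^ (p + 1) by rewrite powR_gt0// divr_gt0.
have ph1 : 0 <= phi 1 / (dl / 2) `^ (p + 1).
  by rewrite divr_ge0 ?ltW// (index_gt0 ip).
exists (Num.max 0 c + phi 1 / (dl / 2) `^ (p + 1)).
  by rewrite addr_ge0// le_max lexx.
move=> l /andP[]; rewrite le_eqVlt => /predU1P[<- _|l0 l1].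
  by rewrite (index_at0 ip) mulr_ge0 ?powR_ge0// addr_ge0// le_max lexx.
have [ld|dl2] := ltP l dl.
  have hl : phi l <= c * l `^ (p + 1).
    by apply: h => //; rewrite -ball_normE/= sub0r normrN gtr0_norm.
  rewrite (le_trans hl)// ler_wpM2r ?powR_ge0//.
  by rewrite -[leLHS]addr0 lerD// le_max lexx orbT.
rewrite (le_trans (index_nondecreasing ip l0 l1))//.
apply: (@le_trans _ _ (phi 1 / (dl / 2) `^ (p + 1) * l `^ (p + 1))).
  rewrite mulrAC ler_pdivlMr// ler_wpM2l ?(ltW (index_gt0 ip _))//.
  apply: ge0_ler_powR; rewrite ?nnegrE ?(ltW p1) ?(ltW l0)// ?divr_ge0 ?(ltW dl0)//.
  by rewrite (le_trans _ dl2)// ler_pdivrMr// ler_peMr ?(ltW dl0)// ler1n.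
by rewrite ler_wpM2r ?powR_ge0// lerDr le_max lexx.
Qed.

End scalar_bounds.

(** * The mean square error *)

Section arm_error.
Context (R : realType) (X Y : hilbertType R).
Hypotheses (X_sep : separable X) (Y_sep : separable Y).
Context (K : X -> Y).
Hypothesis KD : forall x y, K (x + y) = K x + K y.
Hypothesis KZ : forall c x, K (c *: x) = c *: K x.
Hypothesis K_le1 : forall x, `|K x| <= 1 * `|x|.
Context (Omega Omega_half : {linear X -> X}) (p : R).
Hypothesis Omega_pd : positive_definite Omega.
Hypothesis Omega_halfP : is_sqrt Omega Omega_half.
Hypothesis Omega_tr : (trace Omega < +oo)%E.
Hypothesis p_gt0 : 0 < p.
Let KK : X -> X := adjoint K \o K.
Hypothesis Omega_pow : is_fun_calc KK (fun l => l `^ p) Omega.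
Let B : X -> Y := K \o Omega_half.
Let N := effective_dimension (adjoint B \o B).

Let TD : forall x y, KK (x + y) = KK x + KK y := normalD X_sep KD KZ K_le1.
Let TZ : forall c x, KK (c *: x) = c *: KK x := normalZ X_sep KD KZ K_le1.
Let TS : self_adjoint KK := normal_self_adjoint X_sep KD KZ K_le1.
Let T_ge0 : forall x, 0 <= '[x, KK x] := normal_ge0 X_sep KD KZ K_le1.
Let T_le1 x : `|KK x| <= `|x|.
Proof.
by apply: (normal_le1 X_sep KD KZ K_le1) => z; rewrite -[leRHS]mul1r.
Qed.
Let dotT : forall x y, '[KK x, y] = '[K x, K y] := dot_normal X_sep KD KZ K_le1.

Lemma opnorm_normal_le1 : fine (opnorm KK) <= 1.
Proof.
have h : (opnorm KK <= 1%:E)%E.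
  by apply: opnorm_le => x x1; rewrite (le_trans (T_le1 x)).
rewrite -lee_fin fineK// ge0_fin_numE ?opnorm_ge0//.
exact: le_lt_trans h (ltry _).
Qed.

Section eigenbasis.
Context (v : nat -> X) (l : nat -> R).
Hypotheses (vO : ortho_seq v) (vT : total_seq v).
Hypothesis Tv : forall i, KK (v i) = l i *: v i.
Hypothesis l01 : forall i, 0 <= l i <= fine (opnorm KK).

Let mu i := l i `^ p.
Let sig i := l i * mu i.

Let l0 i : 0 <= l i. Proof. by case/andP: (l01 i). Qed.
Let l1 i : l i <= 1.
Proof. by case/andP: (l01 i) => _ h; exact: le_trans h opnorm_normal_le1. Qed.
Let mu0 i : 0 <= mu i. Proof. exact: powR_ge0. Qed.
Let sigE i : sig i = l i `^ (p + 1). Proof. exact: powRS_mul. Qed.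
Let sig0 i : 0 <= sig i. Proof. exact: mulr_ge0. Qed.

Let pow_le1 q : 0 <= q -> forall i, l i `^ q <= 1.
Proof.
move=> q0 i; apply: (@le_trans _ _ (1 `^ q)); last by rewrite powR1.
by apply: ge0_ler_powR => //; rewrite nnegrE.
Qed.

Let sig1 i : sig i <= 1.
Proof. by rewrite sigE pow_le1// addr_ge0// ltW. Qed.

Lemma normal_diagonal : diagonal v l KK.
Proof. by move=> x i; rewrite TS Tv dotZr. Qed.

Lemma fun_calc_diagonal (f : R -> R) (F : X -> X) : is_fun_calc KK f F ->
  forall x i, `|x| <= 1 -> '[F x, v i] = f (l i) * '[x, v i].
Proof. by move=> Ff x i x1; apply: (dot_fun_calc TS Ff (Tv i)). Qed.

Lemma covariance_diagonal : diagonal v mu Omega.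
Proof.
move=> x i; have [->|x0] := eqVneq x 0; first by rewrite linear0 !dot0l mulr0.
have nx : `|x| != 0 by rewrite normr_eq0.
have -> : x = `|x| *: (`|x|^-1 *: x) by rewrite scalerA divff// scale1r.
rewrite linearZ !dotZl (fun_calc_diagonal Omega_pow) ?unit_scale_le1//.
by rewrite dotZl [LHS]mulrCA.
Qed.

Let Omega_inj : injective Omega.
Proof.
move=> a b ab; apply/eqP; rewrite -subr_eq0; apply/negPn/negP => /Omega_pd.
by rewrite linearB ab subrr dot0r ltxx.
Qed.

Lemma covariance_eigen i : Omega (v i) = mu i *: v i.
Proof.
apply: (coef_inj vT) => j; rewrite covariance_diagonal dotZl.
by have [->//|ij] := eqVneq i j; rewrite (ortho_seq_dot vO ij) !mulr0.
Qed.

Lemma covariance_half_norm x : `|Omega_half x| <= 1 * `|x|.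
Proof.
rewrite mul1r -(@ler_pXn2r _ 2) ?nnegrE// -dotp_norm.
rewrite (Defs.sqrt_self_adjoint Omega_halfP) (sqrtK Omega_halfP).
rewrite (le_trans (ler_norm _))// (le_trans (cauchy_schwarz _ _))// expr2.
rewrite ler_wpM2l// -[leRHS]mul1r.
apply: (diagonal_norm_le vO vT ler01 covariance_diagonal) => i.
by rewrite ger0_norm// pow_le1// ltW.
Qed.

Lemma prior_normal_diagonal : diagonal v sig (adjoint B \o B).
Proof.
move=> x i.
have BD a b : B (a + b) = B a + B b by rewrite /B/= linearD KD.
have BZ c a : B (c *: a) = c *: B a by rewrite /B/= linearZ KZ.
have Bb a : `|B a| <= 1 * `|a|.
  by rewrite (le_trans (K_le1 _))// !mul1r -[leRHS]mul1r covariance_half_norm.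
rewrite (dot_normal X_sep BD BZ Bb) /B/=.
have Sv := sqrt_eigen Omega_halfP (mu0 i) (covariance_eigen i).
rewrite Sv KZ dotZr -dotT normal_diagonal.
rewrite (Defs.sqrt_self_adjoint Omega_halfP) Sv dotZr.
by rewrite [LHS]mulrCA [X in _ * X]mulrA -expr2 (sqr_sqrtr (mu0 i)) mulrA.
Qed.

Section bound.
Context (alpha t : R).
Hypotheses (alpha0 : 0 < alpha) (t0 : 0 < t).
Let C0 x := alpha^-1 *: Omega x.
Let Phi := arm_cov C0 KK t \o adjoint K.

Let cov_diag s := diagonal_arm_cov vO vT normal_diagonal covariance_diagonal
  Omega_inj l0 mu0 alpha0 (s := s).
Let flow_diag := diagonal_arm_flow vO vT normal_diagonal covariance_diagonal
  Omega_inj l0 mu0 alpha0 sig1.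

Let den_gt0 s i : 0 <= s -> 0 < alpha + s * sig i.
Proof. by move=> s0; rewrite ltr_wpDr// mulr_ge0. Qed.

Let dotPhi y i : '[Phi y, v i] = '[y, (mu i / (alpha + t * sig i)) *: K (v i)].
Proof.
rewrite /Phi/= (cov_diag (ltW t0)) dotZr (dotC y).
by rewrite (adjoint_dot X_sep KD KZ K_le1) dotC.
Qed.

(** The factor [(alpha + s sig) / (alpha + t sig)] of the flow cancels the
    dependence of the eigenvalues [mu / (alpha + s sig)] on [s]. *)
Lemma arm_integrand_const s y : 0 <= s <= t ->
  (arm_flow C0 KK s t \o arm_cov C0 KK s \o adjoint K) y = Phi y.
Proof.
move=> /andP[s0 st]; apply: (coef_inj vT) => i /=.
rewrite (flow_diag s0 st) (cov_diag s0) (cov_diag (ltW t0)).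
have h1 := den_gt0 i s0; have h2 := den_gt0 i (ltW t0).
by rewrite /sig in h1 h2 *; field; rewrite !gt_eqF.
Qed.

(** Termwise comparison of two series: one factor [mu / (alpha + t sig)] is
    bounded by [variance_scalar], the rest is a term of the effective dimension. *)
Lemma arm_noise_le :
  (t%:E * hs_norm2 Phi <=
   (alpha `^ (- (p + 1)^-1) * t `^ (- (p / (p + 1))))%:E * N (alpha / t)%R)%E.
Proof.
rewrite (hs_norm2_coef vO vT Y_sep dotPhi).
rewrite /N (effective_dimension_diagonal X_sep vO vT _ sig0 prior_normal_diagonal);
  last by rewrite divr_gt0.
have at0 : 0 < alpha / t by rewrite divr_gt0.
rewrite -!nneseriesZl => [|i _|i _]; last 2 first.
- by rewrite lee_fin mulr_ge0 ?dotp_norm ?sqr_ge0// divr_ge0// addr_ge0// ltW.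
- by rewrite lee_fin sqr_ge0.
apply: lee_nneseries => [i _ _|i _].
  by rewrite -EFinM lee_fin mulr_ge0 ?sqr_ge0// ltW.
rewrite -!EFinM lee_fin normrZ exprMn real_normK ?num_real// -dotp_norm.
rewrite -dotT Tv dotZl.
set vv := '[v i, v i]; have vv0 : 0 <= vv by rewrite /vv dotp_norm sqr_ge0.
have d0 := den_gt0 i (ltW t0).
rewrite [leLHS](_ : _ = (mu i / (alpha + t * sig i)) *
    (sig i / (alpha / t + sig i) * vv)).
  apply: ler_wpM2r.
    by rewrite mulr_ge0// divr_ge0// addr_ge0// ltW.
  by rewrite sigE; exact: variance_scalar.
have h3 : 0 < alpha / t + sig i by rewrite ltr_wpDr.
rewrite /sig in d0 h3 *; field; rewrite !gt_eqF//.
by rewrite mulrC.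
Qed.

Lemma arm_bias_le (phi : R -> R) (e : X) (beta : R) :
  source_set KK phi e ->
  (forall x, 0 <= x <= 1 -> 0 <= phi x) ->
  (forall x, 0 <= x <= 1 -> alpha / (alpha + t * x `^ (p + 1)) * phi x <= beta) ->
  `|arm_flow C0 KK 0 t (- e)| ^+ 2 <= beta ^+ 2.
Proof.
move=> [F [Fphi [w [w1 ->]]]] phi0 phi_beta.
have hb i : 0 <= alpha / (alpha + t * sig i) * phi (l i) <= beta.
  rewrite mulr_ge0 ?divr_ge0 ?phi0 ?l0 ?l1 ?(ltW alpha0) ?(ltW (den_gt0 _ (ltW t0)))//=.
  by rewrite sigE phi_beta// l0 l1.
apply: (@le_trans _ _ (beta ^+ 2 * `|w| ^+ 2)); last first.
  by rewrite ler_piMr ?sqr_ge0// exprn_ile1.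
apply: (norm_sqr_le_coef vO vT) => i.
rewrite (flow_diag (lexx 0) (ltW t0)) dotNl (fun_calc_diagonal Fphi)//.
rewrite mul0r addr0 mulrN sqrrN mulrA exprMn ler_wpM2r ?sqr_ge0//.
have /andP[h0 h1] := hb i.
by rewrite lerXn2r ?nnegrE// (le_trans h0).
Qed.

End bound.
End eigenbasis.

(** Both parts of the theorem are choices of [beta]; the range [0, 1] contains
    all eigenvalues of [KK]. *)
Lemma arm_error_le (alpha T t : R) (d : measure_display) (Om : measurableType d)
    (P : probability Om R) (W : R -> Y -> {RV P >-> R}) (m0 u : X)
    (m : R -> Om -> X) (phi : R -> R) (beta : R) :
  0 < alpha -> 0 < t <= T -> cylindrical_wiener T W ->
  is_arm W T K (fun x => alpha^-1 *: Omega x) m0 u m ->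
  source_set KK phi (m0 - u) ->
  (forall x, 0 <= x <= 1 -> 0 <= phi x) ->
  (forall x, 0 <= x <= 1 -> alpha / (alpha + t * x `^ (p + 1)) * phi x <= beta) ->
  ('E_P[fun w => (`|m t w - u| ^+ 2)%R] <= (beta ^+ 2)%:E +
     (alpha `^ (- (p + 1)^-1) * t `^ (- (p / (p + 1))))%:E * N (alpha / t)%R)%E.
Proof.
move=> alpha0 /andP[t0 tT] WP mP src phi0 phi_beta.
have [v [l [vO vT Tv l01]]] := spectral_theorem X_sep TD TZ T_le1 TS T_ge0
  (fun l => powR_gt0 p (a := l)) Omega_pow Omega_halfP Omega_tr.
have [mm [J [JP mJ]]] := mP t (introT andP (conj (ltW t0) tT)).
pose C0 (x : X) := alpha^-1 *: Omega x.
set b := arm_flow C0 KK 0 t (u - m0).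
set Phi := arm_cov C0 KK t \o adjoint K.
have eE : ('E_P[fun w => (`|m t w - u| ^+ 2)%R] = 'E_P[fun w => (`|b - J w| ^+ 2)%R])%E.
  have cn (a : X) : continuous (fun z => `|z - a| ^+ 2 : R).
    move=> z; rewrite /continuous_at expr2.
    by apply: cvgM; apply: cvg_norm; apply: cvgB => //; exact: cvg_cst.
  rewrite !expectationE; apply: ge0_ae_eq_integral => //.
  - by apply/measurable_EFinP; exact: (random_element_comp mm (cn u)).
  - under eq_fun do rewrite distrC.
    by apply/measurable_EFinP; exact: (random_element_comp JP.1 (cn b)).
  - by apply: filterS mJ => w mw _; rewrite distrC mw.
have Phi0 : Phi 0 = 0.
  rewrite /Phi/= (_ : adjoint K 0 = 0); last first.
    by apply: dot_eq => z; rewrite dotC -(adjoint_dot X_sep KD KZ K_le1) dot0r dot0l.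
  apply: (coef_inj vT) => i; rewrite (diagonal_arm_cov vO vT (normal_diagonal Tv)
    (covariance_diagonal Tv l01) _ _ _ alpha0 (ltW t0)) ?dot0l ?mulr0//.
  - move=> a a' aa; apply/eqP; rewrite -subr_eq0; apply/negPn/negP => /Omega_pd.
    by rewrite linearB aa subrr dot0r ltxx.
  - by move=> j; case/andP: (l01 j).
  - by move=> j; exact: powR_ge0.
rewrite eE.
apply: (le_trans (wiener_integral_le Y_sep WP b t0 tT Phi0 _ JP)).
  by move=> s st y; exact: (arm_integrand_const vO vT Tv l01 alpha0 t0 y st).
apply: leeD; last exact: (arm_noise_le vO vT Tv l01 alpha0 t0).
rewrite lee_fin /b -opprB.
exact: (arm_bias_le vO vT Tv l01 alpha0 t0 src phi0 phi_beta).
Qed.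

End arm_error.

Theorem theorem3p3 (R : realType) (X Y : hilbertType R)
  (X_sep : separable X) (Y_sep : separable Y)
  (A : {linear X -> Y}) (A_compact : compact_operator A)
  (Sigma : {linear Y -> Y}) (Sigma_cont : continuous Sigma)
  (Sigma_sa : self_adjoint Sigma) (Sigma_pd : positive_definite Sigma)
  (Omega : {linear X -> X}) (Omega_cont : continuous Omega)
  (Omega_sa : self_adjoint Omega) (Omega_pd : positive_definite Omega)
  (Omega_tr : (trace Omega < +oo)%E)
  (Sigma_half : {linear Y -> Y}) (Sigma_halfP : is_sqrt Sigma Sigma_half)
  (Omega_half : {linear X -> X}) (Omega_halfP : is_sqrt Omega Omega_half)
  (A_range : range A `<=` range Sigma_half) :
  let K : X -> Y := op_inv setT Sigma_half \o A in
  let B : X -> Y := K \o Omega_half in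
  let KK : X -> X := adjoint K \o K in
  let N : R -> \bar R := effective_dimension (adjoint B \o B) in
  forall (K_le1 : (opnorm K <= 1)%E)
    (p : R) (p_gt0 : 0 < p)
    (Omega_pow : is_fun_calc KK (fun l => l `^ p) Omega)
    (u m0 : X)
    (phi : R -> R) (phi_index : index_function phi)
    (source : source_set KK phi (m0 - u)),
  ((forall l l', 0 < l -> l <= l' ->
      phi l' / l' `^ (p + 1) <= phi l / l `^ (p + 1)) ->
   forall (alpha T : R), 0 < alpha -> 0 < T ->
   forall (d : measure_display) (Om : measurableType d)
     (P : probability Om R) (W : R -> Y -> {RV P >-> R}),
   cylindrical_wiener T W ->
   forall m : R -> Om -> X,
   is_arm W T K (fun x => alpha^-1 *: Omega x) m0 u m ->
   forall t, 0 < t <= T ->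
   ('E_P[fun w => (`|m t w - u| ^+ 2)%R] <=
      (phi ((alpha / t) `^ (p + 1)^-1) ^+ 2)%:E +
      (alpha `^ (- (p + 1)^-1) * t `^ (- (p / (p + 1))))%:E * N (alpha / t)%R)%E)
  /\
  ((exists c : R, \forall l \near 0^'+, phi l <= c * l `^ (p + 1)) ->
   exists c' : R,
   forall (alpha T : R), 0 < alpha -> 0 < T ->
   forall (d : measure_display) (Om : measurableType d)
     (P : probability Om R) (W : R -> Y -> {RV P >-> R}),
   cylindrical_wiener T W ->
   forall m : R -> Om -> X,
   is_arm W T K (fun x => alpha^-1 *: Omega x) m0 u m ->
   forall t, 0 < t <= T ->
   ('E_P[fun w => (`|m t w - u| ^+ 2)%R] <=
      (c' * (alpha / t) ^+ 2)%:E +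
      (alpha `^ (- (p + 1)^-1) * t `^ (- (p / (p + 1))))%:E * N (alpha / t)%R)%E).
Proof.
move=> K B KK N K_le1 p p_gt0 Omega_pow u m0 phi phi_index source.
have ShI : {in setT &, injective Sigma_half}.
  by move=> a b _ _; exact: (sqrt_inj Sigma_halfP Sigma_pd).
have ShK x : Sigma_half (K x) = A x.
  have [|y _ Ay] := A_range (A x); first by exists x.
  by rewrite /K/= (op_invE ShI _ Ay).
have KD a b : K (a + b) = K a + K b.
  by apply: ShI; rewrite ?inE// linearD !ShK linearD.
have KZ c a : K (c *: a) = c *: K a.
  by apply: ShI; rewrite ?inE// linearZ/= !ShK linearZ.
have Kb := opnorm_bound KZ K_le1.
have phi0 x : 0 <= x <= 1 -> 0 <= phi x.
  case/andP; rewrite le_eqVlt => /predU1P[<- _|x0 _]; first by rewrite (index_at0 phi_index).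
  exact: ltW (index_gt0 phi_index x0).
split.
  move=> phi_dec alpha T alpha0 T0 d Om P W WP m mP t tT.
  apply: (arm_error_le X_sep Y_sep KD KZ Kb Omega_pd Omega_halfP Omega_tr p_gt0
    Omega_pow alpha0 tT WP mP source phi0) => x /andP[x0 _].
  by apply: (bias_scalar p_gt0 phi_index phi_dec alpha0 _ x0); case/andP: tT.
move=> /(index_le_powR p_gt0 phi_index)[c c0 phi_c]; exists (c ^+ 2).
move=> alpha T alpha0 T0 d Om P W WP m mP t /[dup] tT /andP[t0 _].
rewrite -exprMn.
apply: (arm_error_le X_sep Y_sep KD KZ Kb Omega_pd Omega_halfP Omega_tr p_gt0
  Omega_pow alpha0 tT WP mP source phi0) => x /[dup] x01 /andP[x0 _].
set s := x `^ (p + 1); have s0 : 0 <= s by exact: powR_ge0.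
have d0 : 0 < alpha + t * s by rewrite ltr_wpDr// mulr_ge0// ltW.
apply: (@le_trans _ _ (alpha / (alpha + t * s) * (c * s))).
  by rewrite ler_wpM2l ?phi_c// divr_ge0// ltW.
(* The bias factor is c alpha / t times a number between 0 and 1. *)
rewrite (_ : _ * _ = c * (alpha / t) * (t * s / (alpha + t * s))); last first.
  by field; rewrite !gt_eqF.
rewrite ler_piMr ?mulr_ge0 ?invr_ge0 ?(ltW alpha0) ?(ltW t0)//.
by rewrite ler_pdivrMr// mul1r lerDr ltW.
Qed.
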